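(* Let $M$ be a locally symmetric space, let $p\in M$, and let $\{X,V,\mathcal{A}\}\subset T_pM$ be a good triple. Then $R(X,V)\mathcal{A}=0$, where $R$ denotes the curvature tensor of $M$.
   Context: A locally symmetric space is a Riemannian manifold whose curvature tensor is parallel. Good triple: for a Riemannian manifold $M$ and $p\in M$, a triple $\{X,V,\mathcal{A}\}\subset T_pM$ is called good if $\exp(t\cdot V(s))=\exp(s\cdot X(t))$ for all $s,t\in\mathbb{R}$, where $V(s)$ denotes the Jacobi field along the geodesic $s\mapsto \exp(sX)$ with $V(0)=V$ and $V'(0)=\mathcal{A}$, and $X(t)$ denotes the Jacobi field along the geodesic $t\mapsto\exp(tV)$ with $X(0)=X$ and $X'(0)=\mathcal{A}$. Here $\exp$ is the Riemannian exponential map (at the base point of the vector to which it is applied; these exponentials are understood to be defined) and primes denote covariant derivatives along the geodesic. *)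

(* Defs.v *)
From HB Require Import structures.
From mathcomp Require Import all_boot all_order all_algebra.
From mathcomp Require Import all_classical all_reals all_analysis.
Import Order.TTheory GRing.Theory Num.Theory numFieldNormedType.Exports.
Set Implicit Arguments.
Unset Strict Implicit.
Unset Printing Implicit Defensive.
Local Open Scope classical_set_scope.
Local Open Scope ring_scope.

Definition iter_partial (R : realType) (n : nat) (W : normedModType R)
    (f : 'rV[R]_n -> W) (l : seq 'I_n) : 'rV[R]_n -> W :=
  foldr (fun k (g : 'rV[R]_n -> W) x => 'D_(delta_mx 0 k) g x) f l.

(* C^oo on an open set U: each iterated partial derivative is (Frechet)
   differentiable, hence continuous, on U. *)
Definition smooth_on (R : realType) (n : nat) (W : normedModType R)
    (U : set 'rV[R]_n) (f : 'rV[R]_n -> W) : Prop :=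
  forall (l : seq 'I_n) (x : 'rV[R]_n), U x -> differentiable (iter_partial f l) x.

(* The charts are total functions that matter only on their domains; param i is
   the inverse of coord i. Geometric objects below are given by their
   components in the charts of the atlas (which need not be maximal). *)
Record smoothManifold (R : realType) (n : nat) := SmoothManifold {
  space :> topologicalType ;
  chart : Type ;
  dom : chart -> set space ;
  coord : chart -> space -> 'rV[R]_n ;
  param : chart -> 'rV[R]_n -> space ;
  space_hausdorff : hausdorff_space space ;
  space_second_countable : @second_countable space ;
  dom_cover : forall p, exists i, dom i p ;
  dom_open : forall i, open (dom i) ;
  coord_open : forall i, open (coord i @` dom i) ;
  coordK : forall i p, dom i p -> param i (coord i p) = p ;
  coord_continuous : forall i p, dom i p -> {for p, continuous (coord i)} ;
  param_continuous : forall i p, dom i p ->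
    {for coord i p, continuous (param i)} ;
  transition_smooth : forall i j,
    smooth_on (coord i @` (dom i `&` dom j)) (coord j \o param i)
}.

Definition transition (R : realType) (n : nat) (M : smoothManifold R n)
    (i j : chart M) : 'rV[R]_n -> 'rV[R]_n :=
  coord j \o param i.

Record riemannianManifold (R : realType) (n : nat) := RiemannianManifold {
  manifold :> smoothManifold R n ;
  metric : chart manifold -> 'rV[R]_n -> 'M[R]_n ;
  metric_smooth : forall i, smooth_on (coord i @` dom i) (metric i) ;
  metric_sym : forall i p, dom i p ->
    (metric i (coord i p))^T = metric i (coord i p) ;
  metric_pos : forall i p (u : 'rV[R]_n), dom i p -> u != 0 ->
    0 < (u *m metric i (coord i p) *m u^T) 0 0 ;
  metric_change : forall i j p (u v : 'rV[R]_n), dom i p -> dom j p ->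
    (u *m metric i (coord i p) *m v^T) 0 0 =
    ('D_u (transition i j) (coord i p) *m metric j (coord j p) *m
      ('D_v (transition i j) (coord i p))^T) 0 0
}.

Section TangentVectors.
Context (R : realType) (n : nat) (M : smoothManifold R n).

(* The family of components of a vector in all charts. Components in the charts
   that do not contain the base point are 0, so that the representation is
   unique and equality of vectors is Leibniz equality. *)
Definition tvec : Type := chart M -> 'rV[R]_n.

Definition at_point (p : M) (v : tvec) : tvec :=
  fun i => if `[< dom i p >] then v i else 0.

Definition tangent_space (p : M) : set tvec :=
  [set v | (forall i j, dom i p -> dom j p ->
              v j = 'D_(v i) (transition i j) (coord i p)) /\
           (forall i, ~ dom i p -> v i = 0)].

Definition velocity (gamma : R -> M) (s : R) : tvec :=
  at_point (gamma s) (fun i => derive1 (coord i \o gamma) s).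

Definition differentiable_curve_at (gamma : R -> M) (s : R) : Prop :=
  {for s, continuous gamma} /\
  forall i, dom i (gamma s) -> derivable (coord i \o gamma) s 1.

Definition differentiable_field_at (gamma : R -> M) (J : R -> tvec) (s : R) : Prop :=
  forall i, dom i (gamma s) -> derivable (fun u : R => J u i) s 1.

End TangentVectors.

Arguments tvec {R n} M.

Section Curvature.
Context (R : realType) (n : nat) (M : riemannianManifold R n).
Implicit Types (i : chart M) (x u v w z : 'rV[R]_n).

Definition inner i x u v : R := (u *m metric i x *m v^T) 0 0.

(* For constant vector fields u, v, w this is g(nabla_u v, w), by the Koszul
   formula (the brackets vanish). *)
Definition koszul i x u v w : R :=
  2^-1 * ('D_u (fun y => inner i y v w) x + 'D_v (fun y => inner i y u w) x
          - 'D_w (fun y => inner i y u v) x).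

(* Levi-Civita connection: Gamma(u, v)^k = sum_(a, b) Gamma^k_(ab) u^a v^b. *)
Definition christoffel i x u v : 'rV[R]_n :=
  (\row_l koszul i x u v (delta_mx 0 l)) *m invmx (metric i x).

(* R(X,Y)Z = nabla_X nabla_Y Z - nabla_Y nabla_X Z - nabla_[X,Y] Z, evaluated on
   the constant fields u, v, z. *)
Definition chart_curvature i x u v z : 'rV[R]_n :=
  'D_u (fun y => christoffel i y v z) x - 'D_v (fun y => christoffel i y u z) x
  + christoffel i x u (christoffel i x v z)
  - christoffel i x v (christoffel i x u z).

(* (nabla_w R)(u, v) z *)
Definition chart_nabla_curvature i x w u v z : 'rV[R]_n :=
  'D_w (fun y => chart_curvature i y u v z) x
  + christoffel i x w (chart_curvature i x u v z)
  - chart_curvature i x (christoffel i x w u) v z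
  - chart_curvature i x u (christoffel i x w v) z
  - chart_curvature i x u v (christoffel i x w z).

Definition curvature (p : M) (X Y Z : tvec M) : tvec M :=
  at_point p (fun i => chart_curvature i (coord i p) (X i) (Y i) (Z i)).

Definition locally_symmetric : Prop :=
  forall i p w u v z, dom i p -> chart_nabla_curvature i (coord i p) w u v z = 0.

End Curvature.

Section Geodesics.
Context (R : realType) (n : nat) (M : riemannianManifold R n).

Definition cov_deriv (gamma : R -> M) (J : R -> tvec M) (s : R) : tvec M :=
  at_point (gamma s) (fun i => derive1 (fun u : R => J u i) s
    + christoffel i (coord i (gamma s)) (velocity gamma s i) (J s i)).

(* D is meant to be an open interval. Twice differentiable solutions of the
   geodesic and Jacobi equations are automatically smooth. *)
Definition geodesic_on (D : set R) (gamma : R -> M) : Prop :=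
  forall s, D s ->
    [/\ differentiable_curve_at gamma s,
        differentiable_field_at gamma (velocity gamma) s &
        cov_deriv gamma (velocity gamma) s = 0].

Definition jacobi_field (gamma : R -> M) (J : R -> tvec M) : Prop :=
  forall s,
    [/\ tangent_space (gamma s) (J s),
        differentiable_field_at gamma J s,
        differentiable_field_at gamma (cov_deriv gamma J) s &
        cov_deriv gamma (cov_deriv gamma J) s
        + curvature (gamma s) (J s) (velocity gamma s) (velocity gamma s) = 0].

(* Graph of the partial function exp: exp_p(v) is defined and equal to q. *)
Definition is_exp (p : M) (v : tvec M) (q : M) : Prop :=
  exists (gamma : R -> M) (a b : R),
    [/\ a < 0, 1 < b & geodesic_on [set t | a < t < b] gamma] /\
    [/\ gamma 0 = p, velocity gamma 0 = v & gamma 1 = q].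

(* gamma is the (complete) geodesic s |-> exp_p(s X), and J is the Jacobi field
   along it with J(0) = V and J'(0) = A. *)
Definition jacobi_along_exp (p : M) (X V A : tvec M)
    (gamma : R -> M) (J : R -> tvec M) : Prop :=
  [/\ geodesic_on setT gamma, gamma 0 = p & velocity gamma 0 = X] /\
  [/\ jacobi_field gamma J, J 0 = V & cov_deriv gamma J 0 = A].

Definition good_triple (p : M) (X V A : tvec M) : Prop :=
  [/\ tangent_space p X, tangent_space p V & tangent_space p A] /\
  exists (gamma eta : R -> M) (JV JX : R -> tvec M),
    [/\ jacobi_along_exp p X V A gamma JV, jacobi_along_exp p V X A eta JX &
        forall s t : R, exists q : M,
          is_exp (gamma s) (t *: JV s) q /\ is_exp (eta t) (s *: JX t) q].

End Geodesics.

(* Main.v *)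
Require Import Defs.
From HB Require Import structures.
From mathcomp Require Import all_boot all_order all_algebra.
From mathcomp Require Import all_classical all_reals all_analysis.
From mathcomp Require Import ring lra.
Import Order.TTheory GRing.Theory Num.Theory numFieldNormedType.Exports.
(* Restores the chart operations dom and coord, which vector spaces shadow. *)
Import Defs.
Set Implicit Arguments.
Unset Strict Implicit.
Unset Printing Implicit Defensive.
Local Open Scope classical_set_scope.
Local Open Scope ring_scope.

(** Let f(s, t) = exp (t V(s)) = exp (s X(t)), with partial derivatives X and V
    and A = D_s V = D_t X. The curves t = const and s = const of f are geodesics,
    so V and X are Jacobi fields along them: D_s A = R(X, V) X and
    D_t A = R(V, X) V. Computing D_t D_s A - D_s D_t A = R(V, X) A from these
    equations, with R parallel and the first Bianchi identity, gives
    4 R(X, V) A = 0.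

    This computation is the symmetry of the derivative of f of order two in s and
    order two in t at (0, 0), and f is only known through one geodesic at a time.
    The symmetry is therefore read off from Taylor expansions in a chart at p.
    For fixed s, the short geodesic that defines f(s, t) has an expansion of order
    four in t, uniformly in s near 0 (exp_expansion); its coefficient of t ^ 2 is
    half of c(s) = - Gamma(V(s), V(s)), and those of t ^ 3 and t ^ 4 are
    polynomials in the initial velocity with smooth coefficients, which gives the
    uniformity. For fixed t there is the same expansion in s, where the
    coefficient of s ^ 2 is half of c'(t) = - Gamma(X(t), X(t)). Second differences
    in s and in t at the same scale h have a limit that is computed from either
    expansion, whence c and c' have the same second derivative at 0
    (mixed_second_derivatives).

    The Jacobi equation expresses the second derivative of c at 0 through X, V, A
    and the first two derivatives of Gamma at p (spray_along_jacobi). Exchanging X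
    and V in the result changes it by covariant derivatives of R, which vanish,
    and by 4 R(X, V) A (mixed_term_swap); this identity rests on the symmetries of
    Gamma and of its second derivatives (schwarz). *)

(** * Directional derivatives *)

Lemma near_eq_differentiable (R : realType) (V W : normedModType R)
    (f g : V -> W) (x : V) :
  (\near x, f x = g x) -> differentiable f x -> differentiable g x.
Proof.
move=> fg df.
have Efg : g \o shift x = cst (g x) + 'd f x +o_ (nbhs 0) id.
  apply/eqaddoP => _/posnumP[e].
  have /eqaddoP /(_ e%:num) /(_ [gt0 of e%:num]) := diff_locally df.
  apply: filter_app.
  have : \forall h \near 0, f (h + x) = g (h + x).
    by move: fg; rewrite (near_shift 0)/= subr0.
  apply: filter_app; near=> h => fgh.
  have E (k : V -> W) : (k \o shift x - (cst (k x) + 'd f x)) h =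
    k (h + x) - (k x + 'd f x h) by [].
  by rewrite !E fgh (nbhs_singleton fg).
apply/diff_locallyP; have [[dfc _]] := df.
by have -> := diff_unique dfc Efg.
Unshelve. all: by end_near. Qed.

Lemma is_derive_line (R : realType) (V W : normedModType R) (f : V -> W)
    (x v : V) (df : W) :
  is_derive x v f df <-> is_derive (0 : R) 1 (fun h : R => f (h *: v + x)) df.
Proof.
have E : 'D_v f x = 'D_1 (fun h : R => f (h *: v + x)) 0.
  rewrite /derive; set g1 := fun h => h^-1 *: _; set g2 := fun h => h^-1 *: _.
  suff -> : g1 = g2 by [].
  apply/funext => h; rewrite /g1 /g2 /=.
  by rewrite addr0 scale0r add0r [_%:A]mulr1.
split=> -[d e]; split; [|by rewrite -E| |by rewrite E].
- exact: (derivable1P _ _ _).1 d.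
- exact: (derivable1P _ _ _).2 d.
Qed.

Lemma is_derive_mx (R : realType) (V : normedModType R) m n
    (F : V -> 'M[R]_(m, n)) (x v : V) (dF : 'M[R]_(m, n)) :
  is_derive x v F dF <->
  forall i j, is_derive x v (fun y => F y i j) (dF i j).
Proof.
split=> [[d e] i j|H].
  split; first exact: (derivable_mxP _ _ _).1 d i j.
  by rewrite -e derive_mx// mxE.
have d : derivable F x v by apply/derivable_mxP => i j; apply: ex_derive.
split=> //; rewrite derive_mx//; apply/matrixP => i j; rewrite mxE.
exact: derive_val.
Qed.

Lemma is_derive_comp (R : realType) (V W : normedModType R) (f : V -> W)
    (g : R -> V) (s : R) (dg : V) :
  differentiable f (g s) -> is_derive s 1 g dg ->
  is_derive s 1 (f \o g) ('D_dg f (g s)).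
Proof.
move=> df [dgs <-].
have dgs' : differentiable g s by apply/derivable1_diffP.
have dc : differentiable (f \o g) s by apply: differentiable_comp.
split; first exact: diff_derivable.
by rewrite !deriveE// diff_comp.
Qed.

Lemma derive_linear (R : realType) (V W : normedModType R) (f : V -> W)
    (x : V) a u v :
  differentiable f x -> 'D_(a *: u + v) f x = a *: 'D_u f x + 'D_v f x.
Proof. by move=> df; rewrite !deriveE// linearP. Qed.

Lemma derive_partials (R : realType) n (W : normedModType R)
    (f : 'rV[R]_n -> W) x v :
  differentiable f x -> 'D_v f x = \sum_k v 0 k *: 'D_(delta_mx 0 k) f x.
Proof.
move=> df; rewrite deriveE// [in LHS](row_sum_delta v) linear_sum.
by apply: eq_bigr => k _; rewrite linearZ deriveE.
Qed.

Lemma derivable_continuous (R : realType) (W : normedModType R) (g : R -> W) s :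
  derivable g s 1 -> {for s, continuous g}.
Proof. by move=> /derivable1_diffP /differentiable_continuous. Qed.

Lemma differentiable_near (R : realType) (V W : normedModType R) (f : V -> W)
    (x : V) (e : R) : differentiable f x -> 0 < e ->
  \forall h \near 0, `|f (h + x) - f x - 'D_h f x| <= e * `|h|.
Proof.
move=> df e0; have /eqaddoP /(_ e e0) := diff_locally df.
apply: filter_app; near=> h.
rewrite -[(_ - _) h]/(f (h + x) - (f x + 'd f x h)).
by rewrite deriveE// opprD addrA.
Unshelve. all: by end_near. Qed.

(** The mean value theorem in the direction v turns the second difference into
    h times an increment of the derivative along v, and that increment is linear
    in h up to a small error. *)
Lemma second_difference (R : realType) (V : normedModType R) (f : V -> R)
    (x u v : V) (e : R) :
  (\forall y \near x, differentiable f y) ->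
  differentiable ('D_v f) x -> 0 < e ->
  \forall h \near (0:R)^'+,
    `|f (h *: u + h *: v + x) - f (h *: u + x) - f (h *: v + x) + f x
      - h ^+ 2 * 'D_u ('D_v f) x| <= e * h ^+ 2.
Proof.
move=> dfn dDf e0.
(* The derivative along v is expanded at two points, at distances at most
   h (|u| + |v|) and h |v| from x; 1 is added for positivity. *)
pose C := `|u| + `|v| + `|v| + 1.
have C0 : 0 < C by rewrite ltr_wpDl// !addr_ge0.
have eC : 0 < e / C by rewrite divr_gt0.
have [r1 /= r10 H1] := (nbhs_ballP _ _).1 dfn.
have [r2 /= r20 H2] := (nbhs_ballP _ _).1 (differentiable_near dDf eC).
near=> h.
have h0 : 0 < h by near: h; apply: nbhs_right_gt.
have hr1 : h * C < r1.
  by rewrite -ltr_pdivlMr//; near: h; apply: nbhs_right_lt; rewrite divr_gt0.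
have hr2 : h * C < r2.
  by rewrite -ltr_pdivlMr//; near: h; apply: nbhs_right_lt; rewrite divr_gt0.
have small a t : 0 <= a <= h -> 0 <= t <= h ->
    `|a *: u + t *: v| <= h * (`|u| + `|v|).
  move=> /andP[a0 ah] /andP[t0 th]; rewrite (le_trans (ler_normD _ _))//.
  rewrite !normrZ !ger0_norm// mulrDr lerD// ler_wpM2r//.
have hC : h * (`|u| + `|v|) < h * C.
  by rewrite ltr_pM2l// /C; have := normr_ge0 v; lra.
have dfx a t : 0 <= a <= h -> 0 <= t <= h ->
    differentiable f (a *: u + t *: v + x).
  move=> ha ht; apply: H1; rewrite -ball_normE/= opprD addrCA subrr addr0 normrN.
  exact: le_lt_trans (small _ _ ha ht) (lt_trans hC hr1).
have h0h : 0 <= h <= h by rewrite lexx ltW.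
have z0h : 0 <= (0:R) <= h by rewrite lexx ltW.
pose psi (t : R) := f (t *: v + (h *: u + x)) - f (t *: v + x).
pose D : V -> R := 'D_v f.
pose dpsi (t : R) : R := D (t *: v + (h *: u + x)) - D (t *: v + x).
have dline (y : V) t : differentiable f (t *: v + y) ->
    is_derive t (1:R) (fun t : R => f (t *: v + y)) ('D_v f (t *: v + y)).
  move=> df.
  have dl : is_derive t (1:R) (fun t : R => t *: v + y) v.
    rewrite -[v in X in is_derive _ _ _ X]addr0; apply: is_deriveD.
    apply: DeriveDef; first exact/diff_derivable.
    by rewrite deriveE// diff_val scale1r.
    exact: is_derive_cst.
  exact: (is_derive_comp df dl).
have dpsiP t : 0 <= t <= h -> is_derive t 1 psi (dpsi t).
  move=> ht; apply: is_deriveB; apply: dline.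
    by rewrite addrA [_ *: v + _]addrC; apply: dfx.
  by rewrite -[t *: v]add0r -(scale0r u); apply: dfx.
have [||t th E] := @MVT R psi dpsi 0 h h0.
- by move=> t; rewrite in_itv/= => /andP[t0 th]; apply: dpsiP; rewrite !ltW.
- apply: derivable_within_continuous => t; rewrite in_itv/= => th.
  exact: (@ex_derive _ _ _ _ _ _ _ (dpsiP _ th)).
move: th; rewrite in_itv/= => /andP[t0 th].
have tP : 0 <= t <= h by rewrite !ltW.
rewrite /psi !scale0r !add0r subr0 !addrA [h *: v + h *: u]addrC in E.
have -> : f (h *: u + h *: v + x) - f (h *: u + x) - f (h *: v + x) + f x =
    f (h *: u + h *: v + x) - f (h *: v + x) - (f (h *: u + x) - f x) by ring.
rewrite E /dpsi -[derive f ^~ v]/D.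
have K1 : `|D (t *: v + (h *: u + x)) - D x - 'D_(h *: u + t *: v) D x|
    <= e / C * (h * (`|u| + `|v|)).
  rewrite addrA [_ + h *: u]addrC; apply: le_trans (H2 _ _) _.
    rewrite -ball_normE/= sub0r normrN.
    exact: le_lt_trans (small _ _ h0h tP) (lt_trans hC hr2).
  by rewrite ler_wpM2l ?small// ltW.
have K2 : `|D (t *: v + x) - D x - 'D_(t *: v) D x| <= e / C * (h * `|v|).
  have tv : `|t *: v| <= h * `|v|.
    by rewrite normrZ (gtr0_norm t0) ler_wpM2r ?(ltW th).
  apply: le_trans (H2 _ _) _.
    rewrite -ball_normE/= sub0r normrN (le_lt_trans tv)// (lt_trans _ hr2)//.
    by rewrite ltr_pM2l// /C; have := normr_ge0 u; have := normr_ge0 v; lra.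
  by rewrite ler_wpM2l// ltW.
have L1 : 'D_(h *: u + t *: v) D x = h * 'D_u D x + 'D_(t *: v) D x.
  by rewrite derive_linear.
move: K1 K2; rewrite L1 {L1}.
move: (D (t *: v + (h *: u + x))) (D (t *: v + x)) (D x) ('D_u D x)
  ('D_(t *: v) D x) => d1 d2 d0 du dv.
move=> K1 K2.
have -> : (d1 - d2) * h - h ^+ 2 * du =
   h * ((d1 - d0 - (h * du + dv)) - (d2 - d0 - dv)) by ring.
rewrite normrM (gtr0_norm h0) expr2 mulrCA ler_wpM2l ?(ltW h0)//.
apply: le_trans (ler_normB _ _) _; apply: le_trans (lerD K1 K2) _.
rewrite -mulrDr mulrAC ler_pdivrMr// -mulrA ler_wpM2l ?(ltW e0)//.
rewrite -mulrDr ler_wpM2l ?(ltW h0)//.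
by rewrite /C lerDl.
Unshelve. all: by end_near. Qed.

(** The second difference of f is symmetric in u and v, so that its limit is. *)
Lemma schwarz (R : realType) (V : normedModType R) (f : V -> R) (x u v : V) :
  (\forall y \near x, differentiable f y) ->
  differentiable ('D_u f) x -> differentiable ('D_v f) x ->
  'D_u ('D_v f) x = 'D_v ('D_u f) x.
Proof.
move=> df du dv; apply/eqP; rewrite -subr_eq0 -normr_le0.
apply/ler_addgt0Pr => e e0; rewrite add0r.
have e2 : 0 < e / 2 by rewrite divr_gt0.
have [h [h0 [A B]]] := filter_ex (filterI (nbhs_right_gt (0:R))
  (filterI (second_difference u df dv e2) (second_difference v df du e2))).
have h2 : 0 < h ^+ 2 by rewrite exprn_gt0.
rewrite -(ler_pM2l h2) -{1}(gtr0_norm h2) -normrM.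
rewrite [h *: v + _]addrC in B.
move: A B; move: ('D_u ('D_v f) x) ('D_v ('D_u f) x) => duv dvu.
move: (f (h *: u + h *: v + x)) (f (h *: u + x)) (f (h *: v + x)) (f x) => a b c d A B.
have -> : h ^+ 2 * (duv - dvu) =
  (a - c - b + d - h ^+ 2 * dvu) - (a - b - c + d - h ^+ 2 * duv) by ring.
by apply: le_trans (ler_normB _ _) _; apply: le_trans (lerD B A) _; clear; lra.
Qed.

(** * Smooth functions on an open set *)

Section SmoothFunctions.
Context (R : realType) (n : nat) (U : set 'rV[R]_n).
Hypothesis openU : open U.

Lemma near_open (x : 'rV[R]_n) (P : 'rV[R]_n -> Prop) :
  (forall y, U y -> P y) -> U x -> \forall y \near x, P y.
Proof. by move=> H Ux; apply: filterS H _; apply: open_nbhs_nbhs. Qed.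

Lemma iter_partial_rcons (W : normedModType R) (f : 'rV[R]_n -> W) l k :
  iter_partial f (rcons l k) = iter_partial ('D_(delta_mx 0 k) f) l.
Proof. by rewrite /iter_partial foldr_rcons. Qed.

Lemma smooth_on_partial (W : normedModType R) (f : 'rV[R]_n -> W) k :
  smooth_on U f -> smooth_on U ('D_(delta_mx 0 k) f).
Proof. by move=> sf l x Ux; rewrite -iter_partial_rcons; apply: sf. Qed.

Lemma smooth_on_differentiable (W : normedModType R) (f : 'rV[R]_n -> W) x :
  smooth_on U f -> U x -> differentiable f x.
Proof. by move=> sf; apply: (sf [::]). Qed.

Lemma smooth_on_ext (W : normedModType R) (f g : 'rV[R]_n -> W) :
  (forall x, U x -> f x = g x) -> smooth_on U f -> smooth_on U g.
Proof.
move=> fg sf l x Ux.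
have E y : U y -> iter_partial f l y = iter_partial g l y.
  elim: l y => [|k l IH] y Uy; first exact: fg.
  by rewrite /=; apply: near_eq_derive; apply: near_open IH Uy.
exact: near_eq_differentiable (near_open E Ux) (sf l x Ux).
Qed.

Lemma smooth_on_cst (W : normedModType R) (a : W) : smooth_on U (fun=> a).
Proof.
move=> l x _; suff [c ->] : exists c, iter_partial (fun=> a) l = cst c by [].
elim: l => [|k l [c E]]; first by exists a.
exists 0; rewrite /= E; apply/funext => y.
exact: derive_cst.
Qed.

(** Smooth functions are closed under sums, products and inverses because the
    algebra that they generate consists of differentiable functions and is stable
    under derivatives, which is easier to see than a formula for the iterated
    partial derivatives of a product. *)
Inductive smooth_alg : ('rV[R]_n -> R) -> Prop :=
| smooth_alg_base f : smooth_on U f -> smooth_alg f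
| smooth_alg_add f g : smooth_alg f -> smooth_alg g ->
    smooth_alg (fun x => f x + g x)
| smooth_alg_mul f g : smooth_alg f -> smooth_alg g ->
    smooth_alg (fun x => f x * g x)
| smooth_alg_inv f : smooth_alg f -> (forall x, U x -> f x != 0) ->
    smooth_alg (fun x => (f x)^-1)
| smooth_alg_ext f g : smooth_alg f -> (forall x, U x -> f x = g x) ->
    smooth_alg g.

Lemma smooth_alg_differentiable f x :
  smooth_alg f -> U x -> differentiable f x.
Proof.
move=> sf Ux; elim: sf => {f} [f sf|f g _ df _ dg|f g _ df _ dg|f _ df f0|f g _ df fg].
- exact: smooth_on_differentiable.
- exact: differentiableD.
- exact: differentiableM.
- exact: (differentiableV df (f0 _ Ux)).
- exact: near_eq_differentiable (near_open fg Ux) df.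
Qed.

Lemma smooth_alg_derive f v : smooth_alg f -> smooth_alg ('D_v f).
Proof.
elim=> {f} [f sf|f g sf df sg dg|f g sf df sg dg|f sf df f0|f g sf df fg].
- have E x : U x -> \sum_k v 0 k * 'D_(delta_mx 0 k) f x = 'D_v f x.
    by move=> Ux; rewrite [RHS]derive_partials//; apply: smooth_on_differentiable.
  apply: (smooth_alg_ext _ E); elim: (index_enum _) => [|k s IH].
    apply: (@smooth_alg_ext (cst 0)); first exact/smooth_alg_base/smooth_on_cst.
    by move=> x _; rewrite big_nil.
  apply: (@smooth_alg_ext (fun x => v 0 k * 'D_(delta_mx 0 k) f x +
      \sum_(k <- s) v 0 k * 'D_(delta_mx 0 k) f x)).
    apply: smooth_alg_add => //; apply: smooth_alg_mul.
      exact/smooth_alg_base/smooth_on_cst.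
    exact/smooth_alg_base/smooth_on_partial.
  by move=> x _; rewrite big_cons.
- apply: (smooth_alg_ext (smooth_alg_add df dg)) => x Ux.
  have dfx := diff_derivable (v := v) (smooth_alg_differentiable sf Ux).
  have dgx := diff_derivable (v := v) (smooth_alg_differentiable sg Ux).
  by rewrite [RHS](deriveD dfx dgx).
- apply: (smooth_alg_ext (smooth_alg_add (smooth_alg_mul sf dg)
    (smooth_alg_mul sg df))) => x Ux.
  have dfx := diff_derivable (v := v) (smooth_alg_differentiable sf Ux).
  have dgx := diff_derivable (v := v) (smooth_alg_differentiable sg Ux).
  by rewrite [RHS](deriveM dfx dgx).
- have s1 : smooth_alg (cst (-1)) by exact/smooth_alg_base/smooth_on_cst.
  have si := smooth_alg_inv sf f0.
  apply: (smooth_alg_ext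
    (smooth_alg_mul (smooth_alg_mul s1 (smooth_alg_mul si si)) df)) => x Ux.
  have dfx := diff_derivable (v := v) (smooth_alg_differentiable sf Ux).
  by rewrite [RHS](deriveV (f0 _ Ux) dfx) /= mulN1r expr2 invfM.
- apply: (smooth_alg_ext df) => x Ux.
  by apply: near_eq_derive; apply: near_open fg Ux.
Qed.

Lemma smooth_alg_smooth f : smooth_alg f -> smooth_on U f.
Proof.
move=> sf l; elim/last_ind: l f sf => [|l k IH] f sf x Ux.
  exact: smooth_alg_differentiable.
by rewrite iter_partial_rcons; apply: IH => //; apply: smooth_alg_derive.
Qed.

Lemma smooth_onD (f g : 'rV[R]_n -> R) : smooth_on U f -> smooth_on U g ->
  smooth_on U (fun x => f x + g x).
Proof.
by move=> sf sg; apply/smooth_alg_smooth/smooth_alg_add; apply: smooth_alg_base.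
Qed.

Lemma smooth_onM (f g : 'rV[R]_n -> R) : smooth_on U f -> smooth_on U g ->
  smooth_on U (fun x => f x * g x).
Proof.
by move=> sf sg; apply/smooth_alg_smooth/smooth_alg_mul; apply: smooth_alg_base.
Qed.

Lemma smooth_onV (f : 'rV[R]_n -> R) : smooth_on U f ->
  (forall x, U x -> f x != 0) -> smooth_on U (fun x => (f x)^-1).
Proof.
move=> sf f0; apply: smooth_alg_smooth.
by apply: smooth_alg_inv => //; apply: smooth_alg_base.
Qed.

Lemma smooth_on_derive (f : 'rV[R]_n -> R) v :
  smooth_on U f -> smooth_on U ('D_v f).
Proof. by move=> sf; apply/smooth_alg_smooth/smooth_alg_derive/smooth_alg_base. Qed.

Lemma smooth_onN (f : 'rV[R]_n -> R) : smooth_on U f ->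
  smooth_on U (fun x => - f x).
Proof.
move=> sf; apply: (@smooth_on_ext _ (fun x => -1 * f x)).
  by move=> x _; rewrite mulN1r.
by apply: smooth_onM => //; apply: smooth_on_cst.
Qed.

Lemma smooth_on_sum (I : Type) (s : seq I) (P : pred I)
    (F : I -> 'rV[R]_n -> R) :
  (forall i, P i -> smooth_on U (F i)) ->
  smooth_on U (fun x => \sum_(i <- s | P i) F i x).
Proof.
move=> sF; elim: s => [|i s IH].
  apply: (@smooth_on_ext _ (cst 0)); last exact: smooth_on_cst.
  by move=> x _; rewrite big_nil.
apply: (@smooth_on_ext _ (fun x => (if P i then F i x else 0) +
    \sum_(i <- s | P i) F i x)).
  by move=> x _; rewrite big_cons; case: ifP; rewrite ?add0r.
apply: smooth_onD => //; case: (boolP (P i)) => [/sF//|_].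
exact: smooth_on_cst.
Qed.

Lemma smooth_on_prod (I : Type) (s : seq I) (F : I -> 'rV[R]_n -> R) :
  (forall i, smooth_on U (F i)) -> smooth_on U (fun x => \prod_(i <- s) F i x).
Proof.
move=> sF; elim: s => [|i s IH].
  apply: (@smooth_on_ext R (fun=> (1 : R))); last exact: smooth_on_cst.
  by move=> x _; rewrite big_nil.
apply: (@smooth_on_ext _ (fun x => F i x * \prod_(i <- s) F i x)).
  by move=> x _; rewrite big_cons.
exact: smooth_onM.
Qed.

Lemma smooth_on_det m (A : 'rV[R]_n -> 'M[R]_m) :
  (forall a b, smooth_on U (fun x => A x a b)) -> smooth_on U (fun x => \det (A x)).
Proof.
move=> sA; apply: smooth_on_sum => s _; apply: smooth_onM.
  exact: smooth_on_cst.
exact: smooth_on_prod.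
Qed.

Lemma smooth_on_invmx m (A : 'rV[R]_n -> 'M[R]_m) :
  (forall a b, smooth_on U (fun x => A x a b)) ->
  (forall x, U x -> A x \in unitmx) ->
  forall a b, smooth_on U (fun x => invmx (A x) a b).
Proof.
move=> sA uA a b.
apply: (@smooth_on_ext _ (fun x => (\det (A x))^-1 * cofactor (A x) b a)).
  by move=> x /uA uAx; rewrite /invmx uAx !mxE.
apply: smooth_onM.
  apply: smooth_onV; first exact: smooth_on_det.
  by move=> x /uA; rewrite unitmxE unitfE.
apply: smooth_onM; first exact: smooth_on_cst.
apply: smooth_on_det => i j.
apply: (@smooth_on_ext _ (fun x => A x (lift b i) (lift a j))) => //.
by move=> x _; rewrite !mxE.
Qed.

(** Carries the smoothness of the matrix-valued metric over to its entries. *)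
Lemma smooth_on_entry m p (A : 'rV[R]_n -> 'M[R]_(m, p)) a b :
  smooth_on U A -> smooth_on U (fun x => A x a b).
Proof.
move=> sA l x Ux.
have E y : U y -> iter_partial A l y a b = iter_partial (fun x => A x a b) l y.
  elim: l y => [//|k l IH] y Uy.
  have d : derivable (iter_partial A l) y (delta_mx 0 k).
    exact/diff_derivable/sA.
  rewrite /= (derive_mx d) mxE.
  by apply: near_eq_derive; apply: near_open IH Uy.
apply: near_eq_differentiable (near_open E Ux) _.
apply: (@differentiable_comp _ _ _ _ (iter_partial A l) (fun M => M a b)).
  exact: sA.
exact: differentiable_coord.
Qed.

End SmoothFunctions.

(** * The Christoffel symbols of a chart *)

Section LeviCivita.
Context (R : realType) (n : nat) (M : riemannianManifold R n) (i : chart M).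

Definition chart_image : set 'rV[R]_n := coord i @` dom i.

Lemma chart_image_open : open chart_image. Proof. exact: coord_open. Qed.

Lemma metric_entry_smooth a b : smooth_on chart_image (fun x => metric i x a b).
Proof. exact: (smooth_on_entry chart_image_open _ _ (@metric_smooth _ _ M i)). Qed.

Lemma metric_unitmx x : chart_image x -> metric i x \in unitmx.
Proof.
move=> [q dq <-]; rewrite unitmxE unitfE; apply/negP => /det0P[v v0 vg].
by have := metric_pos dq v0; rewrite vg mul0mx mxE ltxx.
Qed.

Lemma innerE x u v :
  inner i x u v = \sum_b (\sum_a u 0 a * metric i x a b) * v 0 b.
Proof. by rewrite /inner mxE; apply: eq_bigr => b _; rewrite !mxE. Qed.

Lemma inner_smooth u v : smooth_on chart_image (fun x => inner i x u v).
Proof.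
apply: (@smooth_on_ext _ _ _ chart_image_open _ (fun x =>
    \sum_b (\sum_a u 0 a * metric i x a b) * v 0 b)).
  by move=> x _; rewrite innerE.
apply: (smooth_on_sum chart_image_open) => b _.
apply: (smooth_onM chart_image_open); last exact: smooth_on_cst.
apply: (smooth_on_sum chart_image_open) => a _.
apply: (smooth_onM chart_image_open); first exact: smooth_on_cst.
exact: metric_entry_smooth.
Qed.

Lemma inner_linearl x a u u' v :
  inner i x (a *: u + u') v = a * inner i x u v + inner i x u' v.
Proof. by rewrite /inner mulmxDl mulmxDl -!scalemxAl !mxE. Qed.

Lemma inner_sym x u v : chart_image x -> inner i x u v = inner i x v u.
Proof.
move=> [q dq <-]; rewrite /inner; set g := metric i _.
have -> : v *m g *m u^T = (u *m g *m v^T)^T.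
  by rewrite !trmx_mul trmxK (metric_sym dq) mulmxA.
by rewrite [RHS]mxE.
Qed.

Let inner_derivable x u v w : chart_image x ->
  derivable (fun y => inner i y u v) x w.
Proof.
move=> Ux; apply: diff_derivable.
exact: (smooth_on_differentiable (inner_smooth u v) Ux).
Qed.

Lemma derive_inner_linearl x a u u' v w : chart_image x ->
  'D_w (fun y => inner i y (a *: u + u') v) x =
  a * 'D_w (fun y => inner i y u v) x + 'D_w (fun y => inner i y u' v) x.
Proof.
move=> Ux.
have -> : (fun y => inner i y (a *: u + u') v) =
    (a \*: (fun y => inner i y u v)) + (fun y => inner i y u' v).
  by apply/funext => y; rewrite inner_linearl.
have d u0 : derivable (fun y => inner i y u0 v) x w by apply: inner_derivable.
by rewrite (deriveD (derivableZ (k := a) (d u)) (d u')) (deriveZ _ (d u)).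
Qed.

Lemma derive_inner_sym x u v w : chart_image x ->
  'D_w (fun y => inner i y u v) x = 'D_w (fun y => inner i y v u) x.
Proof.
move=> Ux; apply: near_eq_derive.
by apply: (near_open chart_image_open) Ux => y Uy; apply: inner_sym.
Qed.

Lemma koszul_sym x u v w : chart_image x -> koszul i x u v w = koszul i x v u w.
Proof.
move=> Ux; rewrite /koszul (derive_inner_sym u v w Ux).
by rewrite [X in X - _]addrC.
Qed.

Lemma koszul_linear x a u u' v w : chart_image x ->
  koszul i x (a *: u + u') v w = a * koszul i x u v w + koszul i x u' v w.
Proof.
move=> Ux; rewrite /koszul !derive_inner_linearl// derive_linear; last first.
  exact: (smooth_on_differentiable (inner_smooth v w) Ux).
rewrite -[_ *: _]/(_ * _).
move: ('D_u _ x) ('D_u' _ x) => d1 d2.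
move: ('D_v _ x) ('D_v _ x) ('D_w _ x) ('D_w _ x) => d3 d4 d5 d6; ring.
Qed.

Lemma koszul_smooth u v w : smooth_on chart_image (fun x => koszul i x u v w).
Proof.
apply: (smooth_onM chart_image_open); first exact: smooth_on_cst.
apply: (smooth_onD chart_image_open); last first.
  apply: (smooth_onN chart_image_open).
  exact: (smooth_on_derive chart_image_open _ (inner_smooth _ _)).
by apply: (smooth_onD chart_image_open);
  exact: (smooth_on_derive chart_image_open _ (inner_smooth _ _)).
Qed.

Lemma christoffelE x u v k : christoffel i x u v 0 k =
  \sum_l koszul i x u v (delta_mx 0 l) * invmx (metric i x) l k.
Proof. by rewrite mxE; apply: eq_bigr => l _; rewrite mxE. Qed.

(** The inverse of the metric is smooth by the cofactor formula. *)
Lemma christoffel_smooth u v k :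
  smooth_on chart_image (fun x => christoffel i x u v 0 k).
Proof.
apply: (@smooth_on_ext _ _ _ chart_image_open _ (fun x =>
    \sum_l koszul i x u v (delta_mx 0 l) * invmx (metric i x) l k)).
  by move=> x _; rewrite christoffelE.
apply: (smooth_on_sum chart_image_open) => l _.
apply: (smooth_onM chart_image_open); first exact: koszul_smooth.
apply: (smooth_on_invmx chart_image_open); first exact: metric_entry_smooth.
exact: metric_unitmx.
Qed.

Lemma christoffel_sym x u v :
  chart_image x -> christoffel i x u v = christoffel i x v u.
Proof.
move=> Ux; congr (_ *m _); apply/rowP => l; rewrite !mxE.
exact: koszul_sym.
Qed.

Lemma christoffel_linearl x a u u' v : chart_image x ->
  christoffel i x (a *: u + u') v =
  a *: christoffel i x u v + christoffel i x u' v.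
Proof.
move=> Ux; rewrite /christoffel scalemxAl -mulmxDl; congr (_ *m _).
by apply/rowP => l; rewrite !mxE koszul_linear.
Qed.

Lemma christoffel_linearr x a u u' v : chart_image x ->
  christoffel i x v (a *: u + u') =
  a *: christoffel i x v u + christoffel i x v u'.
Proof. by move=> Ux; rewrite !(christoffel_sym v)// christoffel_linearl. Qed.

Lemma christoffelZl x a u v : chart_image x ->
  christoffel i x (a *: u) v = a *: christoffel i x u v.
Proof.
move=> Ux; have c0 : christoffel i x 0 v = 0.
  have := christoffel_linearl 1 0 0 v Ux; rewrite !scale1r addr0.
  by move=> /eqP; rewrite addrC -subr_eq subrr => /eqP.
by rewrite -[a *: u]addr0 christoffel_linearl// c0 addr0.
Qed.

Lemma christoffelZr x a u v : chart_image x ->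
  christoffel i x u (a *: v) = a *: christoffel i x u v.
Proof. by move=> Ux; rewrite !(christoffel_sym u)// christoffelZl. Qed.

End LeviCivita.

(** * Functions of position and velocity *)

Lemma linear_row_sum (R : realType) n (f : 'rV[R]_n -> R) v :
  (forall a u w, f (a *: u + w) = a * f u + f w) ->
  f v = \sum_k v 0 k * f (delta_mx 0 k).
Proof.
move=> flin; have f0 : f 0 = 0.
  by rewrite -[X in f X](addNr (0 : 'rV[R]_n)) -scaleN1r flin mulN1r addNr.
rewrite [in LHS](row_sum_delta v).
elim: (index_enum _) => [|k s IH]; first by rewrite !big_nil f0.
by rewrite !big_cons flin IH.
Qed.

Lemma is_derive_sumf (R : realType) (V : normedModType R) n
    (F : 'I_n -> V -> R) (dF : 'I_n -> R) x v :
  (forall k, is_derive x v (F k) (dF k)) ->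
  is_derive x v (fun y => \sum_k F k y) (\sum_k dF k).
Proof.
move=> H; have -> : (fun y => \sum_k F k y) = \sum_k F k.
  by apply/funext => y; rewrite fct_sumE.
exact: is_derive_sum.
Qed.

Lemma is_derive_unique (R : realType) (V W : normedModType R) (f : V -> W) x v
    (a b : W) : is_derive x v f a -> is_derive x v f b -> a = b.
Proof. by move=> [_ <-] [_ <-]. Qed.

(** Product rule for a linear argument: it suffices to differentiate with this
    argument frozen. Used once for each slot of Gamma and of its derivative. *)
Lemma is_derive_linear_arg (R : realType) n (phi : 'rV[R]_n -> R -> R)
    (dphi : 'rV[R]_n -> R) (v : R -> 'rV[R]_n) s (dv : 'rV[R]_n) :
  (\forall t \near s, forall a u w,
     phi (a *: u + w) t = a * phi u t + phi w t) ->
  (forall u, is_derive s 1 (phi u) (dphi u)) -> is_derive s 1 v dv ->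
  is_derive s 1 (fun t => phi (v t) t) (dphi (v s) + phi dv s).
Proof.
move=> philin dphiP /is_derive_mx dvP.
have sumP (w : R -> 'rV[R]_n) (dw : 'rV[R]_n) :
    (forall k, is_derive s 1 (fun t => w t 0 k) (dw 0 k)) ->
    is_derive s 1 (fun t => phi (w t) t)
      (\sum_k (w s 0 k * dphi (delta_mx 0 k) + phi (delta_mx 0 k) s * dw 0 k)).
  move=> dwP; apply: (@near_eq_is_derive _ _ _ (fun t =>
      \sum_k w t 0 k * phi (delta_mx 0 k) t)).
    near=> t; apply/esym/(@linear_row_sum _ _ (fun u => phi u t)).
    by near: t.
  by apply: is_derive_sumf => k; exact: is_deriveM.
have := sumP v dv (dvP 0); rewrite big_split /=.
rewrite (linear_row_sum dv (nbhs_singleton philin)).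
have -> : dphi (v s) = \sum_k v s 0 k * dphi (delta_mx 0 k).
  apply: is_derive_unique (dphiP (v s)) _.
  have := sumP (fun=> v s) 0; rewrite big_split /= [X in _ + X]big1 ?addr0.
    by apply=> k; rewrite mxE; exact: is_derive_cst.
  by move=> k _; rewrite mxE mulr0.
by congr is_derive; congr (_ + _); apply: eq_bigr => k _; rewrite mulrC.
Unshelve. all: by end_near. Qed.

Section Jets.
Context (R : realType) (n : nat) (U : set 'rV[R]_n).

(** Polynomials in a velocity w with smooth coefficients in the position x. The
    higher derivatives of a geodesic are of this form, which makes them continuous
    functions of position and velocity. *)
Inductive jet : ('rV[R]_n -> 'rV[R]_n -> R) -> Prop :=
| jet_coef f : smooth_on U f -> jet (fun x _ => f x)
| jet_vel k : jet (fun _ w => w 0 k)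
| jet_add f g : jet f -> jet g -> jet (fun x w => f x w + g x w)
| jet_mul f g : jet f -> jet g -> jet (fun x w => f x w * g x w).

Lemma jet_sum (I : Type) (s : seq I) (F : I -> 'rV[R]_n -> 'rV[R]_n -> R) :
  (forall i, jet (F i)) -> jet (fun x w => \sum_(i <- s) F i x w).
Proof.
move=> jF; elim: s => [|i s IH].
  have -> : (fun x w => \sum_(i <- [::]) F i x w) = fun _ _ => 0.
    by apply/funext => x; apply/funext => w; rewrite big_nil.
  by apply: (@jet_coef (fun=> 0)); apply: smooth_on_cst.
have -> : (fun x w => \sum_(j <- i :: s) F j x w) =
    fun x w => F i x w + \sum_(j <- s) F j x w.
  by apply/funext => x; apply/funext => w; rewrite big_cons.
exact: jet_add.
Qed.

Lemma jet_continuous f x0 w0 : jet f -> U x0 ->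
  {for (x0, w0), continuous (fun z : 'rV[R]_n * 'rV[R]_n => f z.1 z.2)}.
Proof.
move=> + Ux; elim=> {f} [f sf|k|f g _ cf _ cg|f g _ cf _ cg].
- apply: (@continuous_comp _ _ _ fst f); first exact: cvg_fst.
  exact/differentiable_continuous/(smooth_on_differentiable sf Ux).
- apply: (@continuous_comp _ _ _ snd (fun w : 'rV[R]_n => w 0 k)).
    exact: cvg_snd.
  exact/differentiable_continuous/differentiable_coord.
- exact: continuousD.
- exact: continuousM.
Qed.

Variable S : 'rV[R]_n -> 'rV[R]_n -> 'rV[R]_n.
Hypothesis jetS : forall k, exists2 g, jet g & forall x w, U x -> S x w 0 k = g x w.

(** The Lie derivative of a jet along the flow x' = w, w' = S(x, w) is a jet. The
    factor t is the speed of a curve that runs through this flow in time t. *)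
Lemma jet_flow f : jet f -> exists2 g, jet g &
  forall (x w : R -> 'rV[R]_n) (t tau : R), U (x tau) ->
    is_derive tau 1 x (t *: w tau) ->
    is_derive tau 1 w (t *: S (x tau) (w tau)) ->
    is_derive tau 1 (fun r => f (x r) (w r)) (t * g (x tau) (w tau)).
Proof.
elim=> {f} [f sf|k|f g jf [f' jf' df] jg [g' jg' dg]
           |f g jf [f' jf' df] jg [g' jg' dg]].
- exists (fun x w => \sum_k w 0 k * 'D_(delta_mx 0 k) f x).
    apply: jet_sum => k; apply: jet_mul; first exact: jet_vel.
    exact/jet_coef/smooth_on_partial.
  move=> x w t tau Ux dx _.
  have df := smooth_on_differentiable sf Ux.
  have := is_derive_comp df dx; congr is_derive.
  rewrite derive_partials// mulr_sumr; apply: eq_bigr => k _.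
  by rewrite mxE mulrA.
- have [g jg gE] := jetS k; exists g => // x w t tau Ux _ /is_derive_mx/(_ 0 k).
  by rewrite mxE gE.
- exists (fun x w => f' x w + g' x w); first exact: jet_add.
  move=> x w t tau Ux dx dw; rewrite mulrDr.
  by apply: is_deriveD; [apply: df|apply: dg].
- exists (fun x w => f x w * g' x w + g x w * f' x w).
    by apply: jet_add; apply: jet_mul.
  move=> x w t tau Ux dx dw.
  have := is_deriveM (df _ _ _ _ Ux dx dw) (dg _ _ _ _ Ux dx dw).
  by congr is_derive; rewrite -![_ *: _]/(_ * _); ring.
Qed.

End Jets.

(** * Geodesics in a chart *)

(** The infimum of the points where P fails would be a point where P holds, hence
    holds nearby. *)
Lemma real_induction (R : realType) (P : R -> Prop) (b : R) :
  P 0 ->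
  (forall t, 0 < t <= b -> (forall s, 0 <= s < t -> P s) -> P t) ->
  (forall t, 0 <= t <= b -> P t -> \forall s \near t, P s) ->
  forall t, 0 <= t <= b -> P t.
Proof.
move=> P0 Pleft Popen t1 t1b; apply: contrapT => nPt1.
pose E := [set t | 0 <= t <= b /\ ~ P t].
have Elb : has_lbound E by exists 0 => t [/andP[]].
have Einf : has_inf E by split=> //; exists t1.
set m := inf E.
have m0 : 0 <= m by apply: lb_le_inf; [exists t1|move=> t [/andP[]]].
have mb : m <= b.
  by apply: le_trans (ge_inf Elb _) (andP t1b).2.
have Plt s : 0 <= s < m -> P s.
  move=> /andP[s0 sm]; apply: contrapT => nPs.
  have /(ge_inf Elb) : E s by split=> //; rewrite s0 (le_trans (ltW sm)).
  by rewrite leNgt sm.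
have Pm : P m.
  move: m0; rewrite le_eqVlt => /orP[/eqP <- //|m0].
  by apply: Pleft => //; rewrite m0.
have /nbhs_ballP[e /= e0 He] : nbhs m P by apply: Popen => //; rewrite m0.
have [s [/andP[s0 sb] nPs] sm] := inf_adherent e0 Einf.
apply: (nPs); apply: He; rewrite -ball_normE /= ler0_norm ?subr_le0.
  by rewrite opprB ltrBlDl.
by apply: (ge_inf Elb); split=> //; rewrite s0 sb.
Qed.

Lemma mean_value_bound (R : realType) (f df : R -> R) (b C : R) :
  0 <= b ->
  (forall s, 0 <= s <= b -> is_derive s 1 f (df s)) ->
  (forall s, 0 < s < b -> `|df s| <= C) -> `|f b - f 0| <= C * b.
Proof.
move=> + fP dfC; rewrite le_eqVlt => /orP[/eqP<-|b0].
  by rewrite subrr normr0 mulr0.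
have [||s sb ->] := @MVT R f df 0 b b0.
- move=> s; rewrite in_itv/= => /andP[s0 sb].
  by apply: fP; rewrite !ltW.
- apply: derivable_within_continuous => s; rewrite in_itv/= => sb.
  exact: (@ex_derive _ _ _ _ _ _ _ (fP _ sb)).
rewrite in_itv/= in sb.
by rewrite subr0 normrM (gtr0_norm b0) ler_wpM2r ?(ltW b0)// dfC.
Qed.

Lemma row_norm_le (R : realType) n (v : 'rV[R]_n) (e : R) : 0 <= e ->
  (forall k, `|v 0 k| <= e) -> `|v| <= e.
Proof.
move=> e0 H; rewrite [leLHS]/Num.Def.normr/= mx_normrE (bigmax_le _ e0)//=.
by move=> [a k] _ /=; rewrite ord1.
Qed.

Lemma row_norm_ge (R : realType) n (v : 'rV[R]_n) k : `|v 0 k| <= `|v|.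
Proof.
rewrite [leRHS]/Num.Def.normr/= mx_normrE.
exact: (@le_bigmax _ _ _ _ (fun ij => `|v ij.1 ij.2|) (0, k)).
Qed.

Lemma row_entry_linear (R : realType) n (a : R) (u v : 'rV[R]_n) k :
  (a *: u + v) 0 k = a * u 0 k + v 0 k.
Proof. by rewrite !mxE. Qed.

Lemma row_entryB (R : realType) n (u v : 'rV[R]_n) k :
  (u - v) 0 k = u 0 k - v 0 k.
Proof. by rewrite !mxE. Qed.

Lemma row_entryZ (R : realType) n (a : R) (u : 'rV[R]_n) k :
  (a *: u) 0 k = a * u 0 k.
Proof. by rewrite mxE. Qed.

Section Geodesics.
Context (R : realType) (n : nat) (M : riemannianManifold R n) (i : chart M).
Local Notation U := (chart_image i).
(* Keeps conversion tests from unfolding the Koszul formula. *)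
Local Opaque christoffel.
Let openU : open U := @chart_image_open _ _ M i.

(** Acceleration of a geodesic in the coordinates of the chart. *)
Definition spray (x w : 'rV[R]_n) : 'rV[R]_n := - christoffel i x w w.

Lemma sprayE x w k : spray x w 0 k = - christoffel i x w w 0 k.
Proof. by rewrite [LHS]mxE. Qed.

Lemma christoffel_row x u v k : U x -> christoffel i x u v 0 k =
  \sum_a u 0 a * \sum_b v 0 b *
    christoffel i x (delta_mx 0 a) (delta_mx 0 b) 0 k.
Proof.
move=> Ux; rewrite (@linear_row_sum _ _ (fun u => christoffel i x u v 0 k)).
  apply: eq_bigr => a _; congr (_ * _).
  apply: (@linear_row_sum _ _ (fun v => christoffel i x _ v 0 k)).
  by move=> c w w'; rewrite christoffel_linearr// row_entry_linear.
by move=> c w w'; rewrite christoffel_linearl// row_entry_linear.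
Qed.

Lemma spray_jet k :
  exists2 g, jet U g & forall x w, U x -> spray x w 0 k = g x w.
Proof.
exists (fun x w => -1 * \sum_a w 0 a * \sum_b w 0 b *
    christoffel i x (delta_mx 0 a) (delta_mx 0 b) 0 k).
  apply: jet_mul; first by apply: (@jet_coef _ _ _ (fun=> -1)); exact: smooth_on_cst.
  apply: jet_sum => a; apply: jet_mul; first exact: jet_vel.
  apply: jet_sum => b; apply: jet_mul; first exact: jet_vel.
  by apply: jet_coef; apply: christoffel_smooth.
by move=> x w Ux; rewrite sprayE christoffel_row// mulN1r.
Qed.

Lemma spray_scale x t w : U x -> spray x (t *: w) = t ^+ 2 *: spray x w.
Proof.
move=> Ux.
by rewrite /spray christoffelZl// christoffelZr// scalerA -expr2 scalerN.
Qed.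

Lemma spray_bound (x0 w0 : 'rV[R]_n) : U x0 ->
  exists C r : R, [/\ 0 < r, 0 <= C & forall x w, `|x - x0| <= r ->
    `|w - w0| <= r -> U x /\ forall k, `|spray x w 0 k| <= C].
Proof.
move=> Ux0.
pose C : R := `|spray x0 w0| + 1.
have H : \forall z \near (x0, w0), U z.1 /\ forall k, `|spray z.1 z.2 0 k| <= C.
  have HU : \forall z \near (x0, w0), U z.1.
    apply: (@cvg_fst _ _ (nbhs x0) (nbhs w0)).
    exact: open_nbhs_nbhs.
  have HC : \forall z \near (x0, w0), forall k, U z.1 -> `|spray z.1 z.2 0 k| <= C.
    apply: (@filter_forall _ _ (fun (k : 'I_n) (z : 'rV[R]_n * 'rV[R]_n) =>
      U z.1 -> `|spray z.1 z.2 0 k| <= C) (nbhs (x0, w0))).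
    move=> k; have [g jg gE] := spray_jet k.
    have /cvgrPdist_lt /(_ 1 ltr01) := jet_continuous (w0 := w0) jg Ux0.
    apply: filterS => z /= /ltW gz Uz; rewrite gE// -[g _ _](subrK (g x0 w0)).
    rewrite (le_trans (ler_normD _ _))// addrC lerD//; last by rewrite distrC.
    by rewrite -gE// row_norm_ge.
  by apply: filterS2 HU HC => z Uz Hz; split=> // k; exact: Hz.
have [r /= r0 Hr] := (nbhs_ballP _ _).1 H.
exists C, (r / 2); split; [by rewrite divr_gt0|by rewrite addr_ge0|].
move=> x w xr wr; apply: (Hr (x, w)).
have r2 : r / 2 < r by rewrite ltr_pdivrMr// ltr_pMr// ltr1n.
by split; rewrite -ball_normE/= distrC; exact: le_lt_trans r2.
Unshelve. all: by end_near. Qed.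

Lemma geodesic_in_chart (D : set R) (c : R -> M) (t : R) :
  geodesic_on D c -> D t -> dom i (c t) ->
  is_derive t 1 (coord i \o c) (velocity c t i) /\
  is_derive t 1 (fun u => velocity c u i) (spray (coord i (c t)) (velocity c t i)).
Proof.
move=> /[apply] -[[_ dc] dv cv] dt; split.
  split; first exact: dc.
  by rewrite /velocity /at_point (asboolT dt) derive1E; reflexivity.
split; first exact: dv.
have := congr1 (fun z : tvec M => z i) cv.
rewrite /cov_deriv /at_point asboolT// derive1E => /eqP.
by rewrite addr_eq0 => /eqP.
Qed.

(** Dividing the velocity by t keeps it bounded when the geodesic starts with a
    velocity of size t and t tends to 0; the equations then carry the factor t. *)
Lemma geodesic_rescaled (D : set R) (c : R -> M) (t r : R) : t != 0 ->
  geodesic_on D c -> D r -> dom i (c r) ->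
  is_derive r 1 (coord i \o c) (t *: (t^-1 *: velocity c r i)) /\
  is_derive r 1 (fun u => t^-1 *: velocity c u i)
    (t *: spray (coord i (c r)) (t^-1 *: velocity c r i)).
Proof.
move=> t0 gc Dr dr; have [dx dv] := geodesic_in_chart gc Dr dr.
split; first by rewrite scalerA divff// scale1r.
apply: (is_derive_eq (@is_deriveZ _ _ _ _ (t^-1) _ _ _ dv)).
rewrite spray_scale; last by exists (c r).
by rewrite [RHS]scalerA expr2 mulrA divff// mul1r.
Qed.

End Geodesics.

(** * Expansion of short geodesics *)

Definition quartic (R : realType) (c0 c1 c2 c3 c4 s : R) : R :=
  c0 + c1 * s + c2 * s ^+ 2 + c3 * s ^+ 3 + c4 * s ^+ 4.

Lemma is_derive_quartic (R : realType) (c0 c1 c2 c3 c4 s : R) :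
  is_derive s 1 (quartic c0 c1 c2 c3 c4)
    (quartic c1 (2 * c2) (3 * c3) (4 * c4) 0 s).
Proof.
pose p : {poly R} := c0%:P + c1 *: 'X + c2 *: 'X^2 + c3 *: 'X^3 + c4 *: 'X^4.
have -> : quartic c0 c1 c2 c3 c4 = horner p.
  by apply/funext => x; rewrite /p /quartic !hornerE.
apply: (is_derive_eq (is_derive_poly p s)).
rewrite /p !(derivD, derivZ, derivC, derivX, derivXn) /quartic /=.
by rewrite !(hornerD, hornerZ, hornerMn, hornerXn, hornerC); ring.
Qed.

(** One step of the Taylor formula: the factor t is gained by an integration. *)
Lemma integrate_bound (R : realType) (h dh : R -> R) (t e : R) :
  (forall s : R, 0 <= s <= 1 -> is_derive s 1 h (t * dh s)) -> h 0 = 0 ->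
  (forall s : R, 0 <= s <= 1 -> `|dh s| <= e) ->
  forall s : R, 0 <= s <= 1 -> `|h s| <= `|t| * e.
Proof.
move=> hP h0 dhe s /andP[s0 s1].
have e0 : 0 <= e by apply: le_trans (dhe 0 _); rewrite ?lexx ?ler01.
rewrite -[h s]subr0 -h0; apply: le_trans (mean_value_bound (C := `|t| * e) s0 _ _) _.
- by move=> r /andP[r0 rs]; apply: hP; rewrite r0 (le_trans rs).
- move=> r /andP[r0 rs]; rewrite normrM ler_wpM2l// dhe// ltW//=.
  by rewrite (le_trans (ltW rs)).
- by rewrite -[leRHS]mulr1 ler_wpM2l// mulr_ge0.
Qed.

(** Each y_(k+1) is, up to the factor t, the derivative of y_k. The remainder is
    integrated four times, starting from the deviation of y4 from q. *)
Lemma taylor4 (R : realType) (y0 y1 y2 y3 y4 : R -> R) (t q e : R) :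
  (forall s : R, 0 <= s <= 1 -> is_derive s 1 y0 (t * y1 s)) ->
  (forall s : R, 0 <= s <= 1 -> is_derive s 1 y1 (t * y2 s)) ->
  (forall s : R, 0 <= s <= 1 -> is_derive s 1 y2 (t * y3 s)) ->
  (forall s : R, 0 <= s <= 1 -> is_derive s 1 y3 (t * y4 s)) ->
  (forall s : R, 0 <= s <= 1 -> `|y4 s - q| <= e) ->
  `|y0 1 - quartic (y0 0) (y1 0) (y2 0 / 2) (y3 0 / 6) (q / 24) t| <= e * t ^+ 4.
Proof.
move=> d0 d1 d2 d3 y4q.
have step (h f : R -> R) c0 c1 c2 c3 c4 e' :
    (forall s : R, 0 <= s <= 1 -> is_derive s 1 h (t * f s)) ->
    h 0 = c0 ->
    (forall s : R, 0 <= s <= 1 ->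
      `|f s - quartic c1 (2 * c2) (3 * c3) (4 * c4) 0 (t * s)| <= e') ->
    forall s : R, 0 <= s <= 1 ->
      `|h s - quartic c0 c1 c2 c3 c4 (t * s)| <= `|t| * e'.
  move=> dh h0 fe; apply: integrate_bound fe => [s s01|]; last first.
    by rewrite h0 mulr0 /quartic; ring.
  rewrite mulrBr; apply: is_deriveB; first exact: dh.
  have := is_derive_quartic c0 (t * c1) (t ^+ 2 * c2) (t ^+ 3 * c3) (t ^+ 4 * c4) s.
  have -> : quartic c0 (t * c1) (t ^+ 2 * c2) (t ^+ 3 * c3) (t ^+ 4 * c4) =
      fun s => quartic c0 c1 c2 c3 c4 (t * s).
    by apply/funext => r; rewrite /quartic; ring.
  by move=> /is_derive_eq; apply; rewrite /quartic; ring.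
have b4 s : 0 <= s <= 1 ->
    `|y4 s - quartic q (2 * 0) (3 * 0) (4 * 0) 0 (t * s)| <= e.
  move=> s01; have -> : quartic q (2 * 0) (3 * 0) (4 * 0) 0 (t * s) = q.
    by rewrite /quartic; ring.
  exact: y4q.
have b3 := step y3 y4 (y3 0) q 0 0 0 _ d3 erefl b4.
have b3' s : 0 <= s <= 1 ->
    `|y3 s - quartic (y3 0) (2 * (q / 2)) (3 * 0) (4 * 0) 0 (t * s)| <= `|t| * e.
  by move=> /b3; congr (`|_ - _| <= _); rewrite /quartic; field.
have b2 := step y2 y3 (y2 0) (y3 0) (q / 2) 0 0 _ d2 erefl b3'.
have b2' s : 0 <= s <= 1 ->
    `|y2 s - quartic (y2 0) (2 * (y3 0 / 2)) (3 * (q / 6)) (4 * 0) 0 (t * s)|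
      <= `|t| * (`|t| * e).
  by move=> /b2; congr (`|_ - _| <= _); rewrite /quartic; field.
have b1 := step y1 y2 (y1 0) (y2 0) (y3 0 / 2) (q / 6) 0 _ d1 erefl b2'.
have b1' s : 0 <= s <= 1 ->
    `|y1 s - quartic (y1 0) (2 * (y2 0 / 2)) (3 * (y3 0 / 6)) (4 * (q / 24)) 0
       (t * s)| <= `|t| * (`|t| * (`|t| * e)).
  by move=> /b1; congr (`|_ - _| <= _); rewrite /quartic; field.
have := step y0 y1 (y0 0) (y1 0) (y2 0 / 2) (y3 0 / 6) (q / 24) _ d0 erefl b1' 1.
rewrite mulr1 ler01 lexx => /(_ isT) /le_trans; apply.
have -> : `|t| * (`|t| * (`|t| * (`|t| * e))) = e * (`|t| ^+ 2) ^+ 2 by ring.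
by rewrite real_normK ?num_real// -exprM.
Qed.

Section ShortGeodesics.
Context (R : realType) (n : nat) (M : riemannianManifold R n) (i : chart M).
Local Notation U := (chart_image i).
Local Opaque christoffel.

(** A coordinate ball is compact, hence closed in the Hausdorff space M: a curve
    cannot leave the chart while its coordinates stay in the ball. *)
Lemma param_ball_closed x0 (r : R) : 0 < r ->
  (forall x, `|x - x0| <= r -> U x) ->
  closed (param i @` [set x | `|x - x0| <= r]).
Proof.
move=> r0 rU; apply: (compact_closed (@space_hausdorff _ _ M)).
apply: continuous_compact.
  apply: continuous_in_subspaceT => x; rewrite inE => /rU[q dq <-].
  exact: param_continuous.
have E : [set x | `|x - x0| <= r] = closed_ball x0 r.
  by rewrite closed_ballE//; apply/seteqP; split => x /=; rewrite distrC.
apply: bounded_closed_compact; last by rewrite E; apply: closed_ball_closed.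
exists (`|x0| + r); split; first exact: num_real.
move=> m mr x /= xr; rewrite -(subrK x0 x) (le_trans (ler_normD _ _))//.
by rewrite addrC (le_trans _ (ltW mr))// lerD2l.
Qed.

(** The velocity is rescaled as in geodesic_rescaled. *)
Definition near_state (c : R -> M) (t : R) x0 w0 (r s : R) : Prop :=
  [/\ dom i (c s), `|coord i (c s) - x0| < r
    & `|t^-1 *: velocity c s i - w0| < r].

(** A geodesic that starts near x0 with velocity near t w0 stays near x0 up to
    time 1, at a velocity near t w0: as long as it does, its coordinates and its
    rescaled velocity have derivatives of size t, so that they move by less than
    the margin that is left. *)
Lemma geodesic_confined (x0 w0 : 'rV[R]_n) (r : R) : U x0 -> 0 < r ->
  exists2 d, 0 < d & forall (c : R -> M) (a b t : R),
    a < 0 -> 1 < b -> geodesic_on [set s | a < s < b] c ->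
    t != 0 -> `|t| < d -> near_state c t x0 w0 d 0 ->
    forall s : R, 0 <= s <= 1 -> near_state c t x0 w0 r s.
Proof.
move=> Ux0 r0; have [C [r1 [r10 C0 Cb]]] := spray_bound w0 Ux0.
pose m := Num.min r r1; have m0 : 0 < m by rewrite lt_min r0.
have mr1 : m <= r1 by rewrite ge_min lexx orbT.
(* Bounds the rescaled velocity and its derivative divided by t. *)
pose B := C + `|w0| + m.
have B0 : 0 < B by rewrite ltr_wpDl// addr_ge0.
pose d := Num.min (m / 2) (m / 2 / B).
have d0 : 0 < d by rewrite lt_min !divr_gt0.
exists d => // c a b t a0 b1 gc t0 td [dc0 xc0 wc0].
have tB : `|t| * B < m / 2.
  by rewrite -ltr_pdivlMr// (lt_le_trans td)// ge_min lexx orbT.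
have dm : d <= m / 2 by rewrite ge_min lexx.
have inD s : 0 <= s <= 1 -> [set s | a < s < b] s.
  by move=> /andP[s0 s1] /=; rewrite (lt_le_trans a0)// (le_lt_trans s1).
pose x := coord i \o c; pose w := fun s : R => t^-1 *: velocity c s i.
have dxw s : 0 <= s <= 1 -> dom i (c s) ->
    is_derive s 1 x (t *: w s) /\ is_derive s 1 w (t *: spray i (x s) (w s)).
  by move=> /inD; apply: geodesic_rescaled.
suff H s : 0 <= s <= 1 -> near_state c t x0 w0 m s.
  move=> s /H[ds xs ws]; have mr : m <= r by rewrite ge_min lexx.
  by split=> //; apply: lt_le_trans mr.
apply: real_induction => {s}.
- have dm' : d <= m by rewrite (le_trans dm)// ler_pdivrMr// ler_pMr// ler1n.
  by split=> //; apply: lt_le_trans dm'.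
- move=> s /andP[s0 s1] Hs.
  have s01 : 0 <= s <= 1 by rewrite ltW.
  have cc : {for s, continuous c} by have [[]] := gc s (inD s s01).
  have ds : dom i (c s).
    have Kc := param_ball_closed (x0 := x0) m0 (fun x xr =>
      (Cb x w0 (le_trans xr mr1) (ltac:(by rewrite subrr normr0 ltW))).1).
    have Kd : param i @` [set x | `|x - x0| <= m] `<=` dom i.
      move=> _ [y /= ym <-].
      have [[q dq <-] _] := Cb y w0 (le_trans ym mr1)
        (ltac:(by rewrite subrr normr0 ltW)).
      by rewrite coordK.
    apply: Kd; apply: contrapT => nK.
    have /cc /nbhs_ballP[e /= e0 He] :
        nbhs (c s) (~` (param i @` [set x | `|x - x0| <= m])).
      by apply: open_nbhs_nbhs; split => //; exact: closed_openC.
    pose s' := Num.max 0 (s - e / 2).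
    have s's : 0 <= s' < s.
      by rewrite le_max lexx /= gt_max s0 /= ltrBlDr ltrDl divr_gt0.
    have [ds' xs' _] := Hs s' s's.
    apply: (He s').
      rewrite -ball_normE/= ger0_norm ?subr_ge0; last by case/andP: s's => _ /ltW.
      rewrite ltrBlDr -ltrBlDl lt_max; apply/orP; right.
      by rewrite ltrD2l ltrN2 ltr_pdivrMr// ltr_pMr// ltr1n.
    by exists (coord i (c s')); [exact: ltW|exact: coordK].
  have dall u : 0 <= u <= s -> dom i (c u).
    move=> /andP[u0]; rewrite le_eqVlt => /orP[/eqP->//|us].
    by have [] := Hs u; rewrite ?u0 ?us.
  have uP u : 0 <= u <= s -> 0 <= u <= 1.
    by move=> /andP[-> /le_trans]; apply.
  have xk k : `|x s 0 k - x 0 0 k| <= m / 2.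
    apply: le_trans (@mean_value_bound _ (fun u => x u 0 k)
       (fun u => t * w u 0 k) s (`|t| * B) (ltW s0) _ _) _.
    + move=> u us; have [/is_derive_mx/(_ 0 k) + _] := dxw u (uP _ us) (dall _ us).
      by rewrite row_entryZ.
    + move=> u /andP[u0 us]; rewrite normrM ler_wpM2l//.
      have [_ _ wu] := Hs u (ltac:(by rewrite ltW// us)).
      apply: le_trans (row_norm_ge _ _) _; rewrite -(subrK w0 (w u)).
      rewrite (le_trans (ler_normD _ _))// addrC /B -addrA -[leLHS]add0r.
      by rewrite lerD// lerD2l ltW.
    + rewrite (le_trans _ (ltW tB))// -[leRHS]mulr1 ler_wpM2l//.
      by rewrite mulr_ge0// ltW.
  have wk k : `|w s 0 k - w 0 0 k| <= m / 2.
    apply: le_trans (@mean_value_bound _ (fun u => w u 0 k)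
       (fun u => t * spray i (x u) (w u) 0 k) s (`|t| * B) (ltW s0) _ _) _.
    + move=> u us; have [_ /is_derive_mx/(_ 0 k)] := dxw u (uP _ us) (dall _ us).
      by rewrite row_entryZ.
    + move=> u /andP[u0 us]; rewrite normrM ler_wpM2l//.
      have [_ xu wu] := Hs u (ltac:(by rewrite ltW// us)).
      have [_ Ck] := Cb _ _ (le_trans (ltW xu) mr1) (le_trans (ltW wu) mr1).
      by apply: le_trans (Ck k) _; rewrite /B -addrA lerDl addr_ge0// ltW.
    + rewrite (le_trans _ (ltW tB))// -[leRHS]mulr1 ler_wpM2l//.
      by rewrite mulr_ge0// ltW.
  have m20 : 0 <= m / 2 by rewrite divr_ge0// ltW.
  split=> //.
  + have /(row_norm_le m20) : forall k, `|(x s - x 0) 0 k| <= m / 2.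
      by move=> k; rewrite row_entryB xk.
    move=> xs; rewrite -[_ - x0](subrKA (x 0)) (le_lt_trans (ler_normD _ _))//.
    by rewrite [ltRHS]splitr ler_ltD// (lt_le_trans xc0).
  + have /(row_norm_le m20) : forall k, `|(w s - w 0) 0 k| <= m / 2.
      by move=> k; rewrite row_entryB wk.
    move=> ws; rewrite -[_ - w0](subrKA (w 0)) (le_lt_trans (ler_normD _ _))//.
    by rewrite [ltRHS]splitr ler_ltD// (lt_le_trans wc0).
- move=> s s01 [ds xs ws].
  have cc : {for s, continuous c} by have [[]] := gc s (inD s s01).
  have [[dx _] [dw _]] := dxw s s01 ds.
  have N1 : \forall u \near s, dom i (c u).
    by apply: cc; apply: open_nbhs_nbhs; split=> //; exact: dom_open.
  have N2 : \forall u \near s, `|x u - x0| < m.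
    have /= := derivable_continuous dx; rewrite /continuous_at.
    move=> /(_ [set y | `|y - x0| < m]); apply.
    apply/nbhs_ballP; exists (m - `|x s - x0|) => /=; first by rewrite subr_gt0.
    move=> y; rewrite -ball_normE/= ltrBrDr distrC => yx.
    rewrite -[y - x0](subrKA (x s)); apply: le_lt_trans yx.
    exact: ler_normD.
  have N3 : \forall u \near s, `|w u - w0| < m.
    have /= := derivable_continuous dw; rewrite /continuous_at.
    move=> /(_ [set y | `|y - w0| < m]); apply.
    apply/nbhs_ballP; exists (m - `|w s - w0|) => /=; first by rewrite subr_gt0.
    move=> y; rewrite -ball_normE/= ltrBrDr distrC => yx.
    rewrite -[y - w0](subrKA (w s)); apply: le_lt_trans yx.
    exact: ler_normD.
  by near=> u; split; near: u.
Unshelve. all: by end_near. Qed.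

(** The coefficients up to t ^ 3 depend on the initial position and velocity; that
    of t ^ 4 is taken at (x0, w0), and the error of doing so is absorbed by e. The
    bound is uniform because a jet is continuous and the whole geodesic stays
    near (x0, w0). *)
Lemma exp_expansion (x0 w0 : 'rV[R]_n) k : U x0 ->
  exists (h : 'rV[R]_n -> 'rV[R]_n -> R) (Q : R), forall e : R, 0 < e ->
  exists2 d : R, 0 < d & forall (y q : M) (v : tvec M) (t : R),
    is_exp y (t *: v) q -> t != 0 -> `|t| < d -> dom i y ->
    `|coord i y - x0| < d -> `|v i - w0| < d ->
    `|coord i q 0 k - quartic (coord i y 0 k) (v i 0 k)
        (spray i (coord i y) (v i) 0 k / 2) (h (coord i y) (v i) / 6) (Q / 24) t|
    <= e * t ^+ 4.
Proof.
move=> Ux0; have [g2 jg2 g2E] := spray_jet i k.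
have [g3 jg3 dg2] := jet_flow (spray_jet i) jg2.
have [g4 jg4 dg3] := jet_flow (spray_jet i) jg3.
exists g3, (g4 x0 w0) => e e0.
have /cvgrPdist_le /(_ e e0) := jet_continuous (w0 := w0) jg4 Ux0.
move=> /nbhs_ballP[r /= r0 Hr].
have [d d0 Hd] := geodesic_confined w0 Ux0 r0.
exists d => // y q v t [c [a [b [[a0 b1 gc] [c0 vc0 c1]]]]] t0 td dy yd vd.
pose x := coord i \o c; pose w := fun s : R => t^-1 *: velocity c s i.
have w0E : w 0 = v i.
  by rewrite /w vc0 -[(t *: v) i]/(t *: v i) scalerA mulVf// scale1r.
have x0E : x 0 = coord i y by rewrite /x /= c0.
have st : near_state c t x0 w0 d 0 by split; rewrite ?c0// -/(w 0) w0E.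
have conf := Hd c a b t a0 b1 gc t0 td st.
have dxw (s : R) : 0 <= s <= 1 -> [/\ U (x s), is_derive s 1 x (t *: w s) &
    is_derive s 1 w (t *: spray i (x s) (w s))].
  move=> s01; have [ds _ _] := conf s s01.
  have sab : [set s | a < s < b] s.
    by move: s01 => /andP[s0 s1] /=; rewrite (lt_le_trans a0)// (le_lt_trans s1).
  by have [dx dw] := geodesic_rescaled t0 gc sab ds; split=> //; exists (c s).
have Ux s : 0 <= s <= 1 -> U (x s) by move=> /dxw[].
have := @taylor4 R (fun s => x s 0 k) (fun s => w s 0 k)
  (fun s => g2 (x s) (w s)) (fun s => g3 (x s) (w s))
  (fun s => g4 (x s) (w s)) t (g4 x0 w0) e.
rewrite w0E x0E -g2E; last by rewrite -x0E; apply: Ux; rewrite lexx ler01.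
rewrite /x /= c1; apply.
- by move=> s /dxw[_ /is_derive_mx/(_ 0 k) + _]; rewrite row_entryZ.
- by move=> s /dxw[Uxs _ /is_derive_mx/(_ 0 k)]; rewrite row_entryZ g2E.
- by move=> s /dxw[Uxs dx dw]; apply: dg2.
- by move=> s /dxw[Uxs dx dw]; apply: dg3.
- move=> s /conf[_ xs ws]; rewrite distrC.
  by apply: (Hr (x s, w s)); split; rewrite -ball_normE/= distrC.
Qed.

End ShortGeodesics.

(** * Comparison of two expansions *)

Lemma is_derive_dilation (R : realType) (f : R -> R) (s u df : R) :
  is_derive (u * s) 1 f df -> is_derive u 1 (fun r => f (r * s)) (s * df).
Proof.
move=> [d e].
have df' : differentiable f (u * s) by apply/derivable1_diffP.
have dm : is_derive u (1:R) (fun r : R => r * s) s.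
  have H := @is_deriveM _ _ (fun r : R => r) (fun=> s) u 1 1 0
    (is_derive_id _ _) (is_derive_cst _ _ _).
  by apply: (is_derive_eq H); rewrite scaler0 add0r [LHS]mulr1.
suff <- : 'D_s f (u * s) = s * df by exact: (is_derive_comp (g := fun r => r * s) df' dm).
have := derive_linear s (1 : R) (0 : R) df'; rewrite derive0 !addr0 e.
by rewrite -[_ *: 1]/(s * 1) mulr1.
Qed.

(** Second order expansion at 0 for a function that is only twice differentiable
    at 0. *)
Lemma taylor2 (R : realType) (f f1 : R -> R) (f2 e : R) :
  (\forall s \near (0:R), is_derive (s : R) 1 f (f1 s)) -> is_derive (0:R) 1 f1 f2 ->
  0 < e -> \forall s \near (0:R),
    `|f s - quartic (f 0) (f1 0) (f2 / 2) 0 0 s| <= e * s ^+ 2.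
Proof.
move=> fP [d2 e2] e0.
have df1 : differentiable f1 0 by apply/derivable1_diffP.
have [r /= r0 Hr] := (nbhs_ballP _ _).1 (filterI fP (differentiable_near df1 e0)).
apply/nbhs_ballP; exists r => // s; rewrite -ball_normE/= sub0r normrN => sr.
have inr u : 0 <= u <= 1 -> `|u * s| < r.
  move=> /andP[u0 u1]; apply: le_lt_trans sr.
  by rewrite normrM -[leRHS]mul1r ler_wpM2r// ger0_norm.
have Hs u : 0 <= u <= 1 -> is_derive (u * s) 1 f (f1 (u * s)) /\
    `|f1 (u * s) - quartic (f1 0) f2 0 0 0 (u * s)| <= e * `|s|.
  move=> u01; have [|fd f1d] := Hr (u * s).
    by rewrite -ball_normE/= sub0r normrN inr.
  split=> //.
  have := derive_linear (u * s) (1 : R) (0 : R) df1; rewrite derive0 !addr0 e2.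
  rewrite -[_ *: 1]/(u * s * 1) mulr1 => E.
  move: f1d; rewrite addr0 E -[_ *: f2]/(u * s * f2) => f1d.
  have -> : f1 (u * s) - quartic (f1 0) f2 0 0 0 (u * s) =
      f1 (u * s) - f1 0 - u * s * f2 by rewrite /quartic; ring.
  apply: le_trans f1d _; rewrite ler_wpM2l ?(ltW e0)//.
  by case/andP: u01 => u0 u1; rewrite normrM -[leRHS]mul1r ler_wpM2r// ger0_norm.
have := @integrate_bound R
  (fun u => f (u * s) - quartic (f 0) (f1 0) (f2 / 2) 0 0 (u * s))
  (fun u => f1 (u * s) - quartic (f1 0) f2 0 0 0 (u * s)) s (e * `|s|).
have -> : e * s ^+ 2 = `|s| * (e * `|s|).
  by rewrite -(real_normK (num_real s)) expr2 mulrCA.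
move=> H; have := H _ _ _ 1; rewrite mul1r; apply.
- move=> u /Hs[fd _]; rewrite mulrBr; apply: is_deriveB.
    exact: is_derive_dilation fd.
  apply: is_derive_dilation.
  apply: (is_derive_eq (is_derive_quartic _ _ _ _ _ _)).
  by rewrite /quartic; field.
- by rewrite mul0r /quartic; ring.
- by move=> u /Hs[].
- by rewrite ler01 lexx.
Qed.

(** A second difference that does not involve the value at 0, where the rescaled
    velocity of a geodesic makes no sense. It kills constants and odd powers, and
    equals 6 h ^ 2 on the square. *)
Definition stencil (R : realType) (f : R -> R) (h : R) : R :=
  f (2 * h) + f (- (2 * h)) - f h - f (- h).

Lemma stencil_bound (R : realType) (f : R -> R) (h e : R) :
  `|f (2 * h)| <= e -> `|f (- (2 * h))| <= e -> `|f h| <= e -> `|f (- h)| <= e ->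
  `|stencil f h| <= 4 * e.
Proof.
rewrite /stencil; move: (f _) (f (- (2 * h))) (f h) (f (- h)) => a b c d.
rewrite !ler_norml => /andP[a1 a2] /andP[b1 b2] /andP[c1 c2] /andP[d1 d2].
by apply/andP; split; lra.
Qed.

Lemma stencilB (R : realType) (f g : R -> R) h :
  stencil (fun s => f s - g s) h = stencil f h - stencil g h.
Proof. by rewrite /stencil; ring. Qed.

Lemma stencil_quartic (R : realType) (c0 c1 c2 c3 c4 h : R) :
  stencil (quartic c0 c1 c2 c3 c4) h = 6 * c2 * h ^+ 2 + 30 * c4 * h ^+ 4.
Proof. by rewrite /stencil /quartic; ring. Qed.

Lemma stencil_swap (R : realType) (F : R -> R -> R) h :
  stencil (fun s => stencil (F s) h) h =
  stencil (fun t => stencil (F^~ t) h) h.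
Proof. by rewrite /stencil; ring. Qed.

Lemma stencil_near (R : realType) (P : R -> Prop) :
  (\forall s \near (0:R), P s) ->
  exists2 d, 0 < d & forall h, 0 < h < d ->
    [/\ P (2 * h), P (- (2 * h)), P h & P (- h)].
Proof.
move=> /nbhs_ballP[r /= r0 Hr]; exists (r / 2); first by rewrite divr_gt0.
move=> h /andP[h0 hr]; have h2 : 2 * h < r by rewrite mulrC -ltr_pdivlMr.
have hr' : h < r by lra.
by split; apply: Hr; rewrite -ball_normE/= sub0r ?normrN gtr0_norm// mulr_gt0.
Qed.

(** Taking the stencil in t first leaves 3 c(s) h ^ 2 and a term in h ^ 4 that is
    constant in s; the stencil in s kills this constant and turns c into
    3 c2 h ^ 2. *)
Lemma mixed_stencil (R : realType) (F : R -> R -> R) (a b c d : R -> R)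
    (q al be c2 : R) :
  (forall e, 0 < e -> exists2 r, 0 < r & forall s t, `|s| < r -> t != 0 ->
     `|t| < r -> `|F s t - quartic (a s) (b s) (c s / 2) (d s) q t| <= e * t ^+ 4) ->
  (forall e, 0 < e -> \forall s \near (0:R),
     `|c s - quartic al be (c2 / 2) 0 0 s| <= e * s ^+ 2) ->
  forall e, 0 < e -> \forall h \near (0:R)^'+,
    `|stencil (fun s => stencil (F s) h) h - 9 * c2 * h ^+ 4| <= e * h ^+ 4.
Proof.
move=> HF Hc e e0.
(* In units of e1, each of the four values of s brings four errors in t of at most
   16 h ^ 4, and the expansion of c brings 3 h ^ 2 times four errors of at most
   4 h ^ 2. The total is 4 * 4 * 16 + 3 * 4 * 4 = 16 * 19 times h ^ 4. *)
pose e1 := e / 16 / 19.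
have e10 : 0 < e1 by rewrite !divr_gt0.
have eE : e = 16 * 19 * e1 by rewrite /e1; field.
have [r r0 {}HF] := HF _ e10.
have [r1 r10 {}Hc] := stencil_near (Hc _ e10).
near=> h.
have h0 : 0 < h by near: h; apply: nbhs_right_gt.
have hr1 : h < r1 by near: h; apply: nbhs_right_lt.
have hr : 2 * h < r.
  by rewrite mulrC -ltr_pdivlMr//; near: h; apply: nbhs_right_lt; rewrite divr_gt0.
have hr' : h < r by lra.
pose Q s t := quartic (a s) (b s) (c s / 2) (d s) q t.
have h4 : 0 <= h ^+ 4 by rewrite exprn_ge0// ltW.
have inner s : `|s| < r -> `|stencil (fun t => F s t - Q s t) h| <=
    4 * (e1 * (16 * h ^+ 4)).
  move=> sr; have t16 t : t \in [:: 2 * h; - (2 * h); h; - h] ->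
      `|F s t - Q s t| <= e1 * (16 * h ^+ 4).
    move=> tin.
    have [t0 tr t4] : [/\ t != 0, `|t| < r & t ^+ 4 <= 16 * h ^+ 4].
      move: tin; rewrite !inE => /or4P[] /eqP->;
        rewrite ?normrN ?oppr_eq0 ?gtr0_norm ?mulr_gt0//;
        split=> //; rewrite ?mulf_neq0 ?gt_eqF//.
      + by have -> : (2 * h) ^+ 4 = 16 * h ^+ 4 by ring.
      + by have -> : (- (2 * h)) ^+ 4 = 16 * h ^+ 4 by ring.
      + by rewrite -[leLHS]mul1r ler_wpM2r// ler1n.
      + have -> : (- h) ^+ 4 = h ^+ 4 by ring.
        by rewrite -[leLHS]mul1r ler_wpM2r// ler1n.
    by apply: le_trans (HF s t sr t0 tr) _; rewrite ler_wpM2l// ltW.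
  by apply: stencil_bound; apply: t16; rewrite !inE eqxx ?orbT.
have innerE s : stencil (fun t => F s t - Q s t) h =
    stencil (F s) h - (3 * c s * h ^+ 2 + 30 * q * h ^+ 4).
  by rewrite stencilB /Q stencil_quartic; field.
have outer : `|stencil (fun s => stencil (F s) h -
    (3 * c s * h ^+ 2 + 30 * q * h ^+ 4)) h| <= 4 * (4 * (e1 * (16 * h ^+ 4))).
  by apply: stencil_bound; rewrite -innerE; apply: inner;
    rewrite ?normrN gtr0_norm ?mulr_gt0.
have cb : `|stencil (fun s => c s - quartic al be (c2 / 2) 0 0 s) h| <=
    4 * (e1 * (4 * h ^+ 2)).
  have h2 : 0 <= h ^+ 2 by rewrite exprn_ge0// ltW.
  have [|A1 A2 A3 A4] := Hc h; first by rewrite h0.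
  apply: stencil_bound.
  - by apply: le_trans A1 _; rewrite exprMn; lra.
  - by apply: le_trans A2 _; rewrite sqrrN exprMn; lra.
  - by apply: le_trans A3 _; rewrite ler_wpM2l ?(ltW e10)//; lra.
  - by apply: le_trans A4 _; rewrite sqrrN ler_wpM2l ?(ltW e10)//; lra.
rewrite stencilB stencil_quartic in cb.
have E : stencil (fun s => stencil (F s) h) h - 9 * c2 * h ^+ 4 =
  stencil (fun s => stencil (F s) h - (3 * c s * h ^+ 2 + 30 * q * h ^+ 4)) h +
  3 * h ^+ 2 * (stencil c h - (6 * (c2 / 2) * h ^+ 2 + 30 * 0 * h ^+ 4)).
  by rewrite /stencil; field.
rewrite E; apply: le_trans (ler_normD _ _) _.
have -> : e * h ^+ 4 = 4 * (4 * (e1 * (16 * h ^+ 4))) +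
    3 * h ^+ 2 * (4 * (e1 * (4 * h ^+ 2))) by rewrite eE; ring.
apply: lerD => //; rewrite normrM ger0_norm; last by rewrite mulr_ge0// exprn_ge0// ltW.
by rewrite ler_wpM2l// mulr_ge0// exprn_ge0// ltW.
Unshelve. all: by end_near. Qed.

(** A function F with an expansion in t, uniform in s, and one in s, uniform in t:
    the coefficients of t ^ 2 and of s ^ 2 have the same second derivative at 0,
    because the stencils in s and in t commute. This replaces the symmetry of the
    derivatives of F, which need not exist. *)
Lemma mixed_second_derivatives (R : realType) (F : R -> R -> R)
    (a b c d a' b' c' d' : R -> R) (q al be c2 q' al' be' c2' : R) :
  (forall e, 0 < e -> exists2 r, 0 < r & forall s t, `|s| < r -> t != 0 ->
     `|t| < r -> `|F s t - quartic (a s) (b s) (c s / 2) (d s) q t| <= e * t ^+ 4) ->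
  (forall e, 0 < e -> exists2 r, 0 < r & forall t s, `|t| < r -> s != 0 ->
     `|s| < r ->
     `|F s t - quartic (a' t) (b' t) (c' t / 2) (d' t) q' s| <= e * s ^+ 4) ->
  (forall e, 0 < e -> \forall s \near (0:R),
     `|c s - quartic al be (c2 / 2) 0 0 s| <= e * s ^+ 2) ->
  (forall e, 0 < e -> \forall t \near (0:R),
     `|c' t - quartic al' be' (c2' / 2) 0 0 t| <= e * t ^+ 2) ->
  c2 = c2'.
Proof.
move=> H H' Hc Hc'; apply/eqP; rewrite -subr_eq0 -normr_le0.
apply/ler_addgt0Pr => e e0; rewrite add0r.
have [h [h0 [A B]]] := filter_ex (filterI (nbhs_right_gt (0:R))
  (filterI (mixed_stencil H Hc e0) (mixed_stencil (F := fun t s => F s t) H' Hc' e0))).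
have h4 : 0 < h ^+ 4 by rewrite exprn_gt0.
rewrite stencil_swap in A.
move: A B; set T := stencil _ h => A B.
rewrite -(ler_pM2l h4) -{1}(gtr0_norm h4) -normrM.
move: A B; move: (h ^+ 4) h4 T => k k0 T; rewrite !ler_norml.
by move=> /andP[A1 A2] /andP[B1 B2]; apply/andP; split; nra.
Qed.

(** * The multilinear curvature identity *)

Section CurvatureAlgebra.
Context (R : realType) (n : nat).
Local Notation E := 'rV[R]_n.
Variables (B : E -> E -> E) (D1 : E -> E -> E -> E) (D2 : E -> E -> E -> E -> E).

(** B, D1 and D2 stand for the Christoffel symbols at a point and their first and
    second derivatives, the arguments of Gamma coming last. The next two formulas
    are the curvature and its covariant derivative in these terms. *)
Definition alg_curvature (u v z : E) : E :=
  D1 u v z - D1 v u z + B u (B v z) - B v (B u z).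

Definition alg_nabla_curvature (w u v z : E) : E :=
  (D2 w u v z - D2 w v u z + (D1 w u (B v z) + B u (D1 w v z))
    - (D1 w v (B u z) + B v (D1 w u z)))
  + B w (alg_curvature u v z) - alg_curvature (B w u) v z
  - alg_curvature u (B w v) z - alg_curvature u v (B w z).

(** The second derivative along s, at s = 0, of - Gamma(V, V) for a Jacobi field V
    with covariant derivative A along a geodesic of velocity X. Here V1 and V2 are
    the first two derivatives of V, X1 and A1 those of X and A, from the geodesic
    and the Jacobi equation. *)
Definition mixed_term (X V A : E) : E :=
  let V1 := A - B X V in
  let X1 := - B X X in
  let A1 := - alg_curvature V X X - B X A in
  let V2 := A1 - (D1 X X V + B X V1 + B X1 V) in
  - (D2 X X V V + D1 X1 V V + D1 X V1 V + D1 X V V1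
     + 2 *: (D1 X V V1 + B V V2 + B V1 V1)).

Hypothesis Bsym : forall u v, B u v = B v u.
Hypothesis Blin : forall u a v w, B u (a *: v + w) = a *: B u v + B u w.
Hypothesis D1lin1 : forall a u u' v w,
  D1 (a *: u + u') v w = a *: D1 u v w + D1 u' v w.
Hypothesis D1sym : forall u v w, D1 u v w = D1 u w v.
Hypothesis D1lin3 : forall u v a w w',
  D1 u v (a *: w + w') = a *: D1 u v w + D1 u v w'.
Hypothesis D2sym12 : forall u u' v w, D2 u u' v w = D2 u' u v w.
Hypothesis D2sym34 : forall u u' v w, D2 u u' v w = D2 u u' w v.

Let BD u v w : B u (v + w) = B u v + B u w.
Proof. by rewrite -[v]scale1r Blin !scale1r. Qed.

Let BN u v : B u (- v) = - B u v.
Proof.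
have B0 : B u 0 = 0 by have := Blin u (-1) 0 0; rewrite !scaleN1r oppr0 addr0 addNr.
by rewrite -[- v]addr0 -scaleN1r Blin B0 scaleN1r addr0.
Qed.

Let D1N1 u v w : D1 (- u) v w = - D1 u v w.
Proof.
have D0 : D1 0 v w = 0.
  by have := D1lin1 (-1) 0 0 v w; rewrite !scaleN1r oppr0 addr0 addNr.
by rewrite -[- u]addr0 -scaleN1r D1lin1 D0 scaleN1r addr0.
Qed.

Let D1D3 u v w w' : D1 u v (w + w') = D1 u v w + D1 u v w'.
Proof. by rewrite -[w]scale1r D1lin3 !scale1r. Qed.

Let D1N3 u v w : D1 u v (- w) = - D1 u v w.
Proof.
have D0 : D1 u v 0 = 0.
  by have := D1lin3 u v (-1) 0 0; rewrite !scaleN1r oppr0 addr0 addNr.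
by rewrite -[- w]addr0 -scaleN1r D1lin3 D0 scaleN1r addr0.
Qed.

Let BDl u v w : B (u + v) w = B u w + B v w.
Proof. by rewrite !(Bsym _ w) BD. Qed.

Let BNl u w : B (- u) w = - B u w.
Proof. by rewrite !(Bsym _ w) BN. Qed.

Let D1D2 u v w w' : D1 u (w + w') v = D1 u w v + D1 u w' v.
Proof. by rewrite !(D1sym _ _ v) D1D3. Qed.

Let D1N2 u v w : D1 u (- w) v = - D1 u w v.
Proof. by rewrite !(D1sym _ _ v) D1N3. Qed.

(** The coordinate form of the commutation of D_s and D_t on A, where the Bianchi
    identity is contained in the symmetry of B and of D1. It is checked by
    expanding both sides and sorting symmetric arguments. *)
Lemma mixed_term_swap X V A :
  mixed_term X V A - mixed_term V X A =
  alg_nabla_curvature X V X V - alg_nabla_curvature V X V X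
  - 4 *: alg_curvature X V A.
Proof.
rewrite /mixed_term /alg_nabla_curvature /alg_curvature.
rewrite !(BD, BN, BDl, BNl, D1N1, D1D2, D1N2, D1D3, D1N3).
rewrite (Bsym V X) (Bsym A (B _ _)) !(Bsym (B X X) (B V V)).
rewrite !(Bsym (B _ _) X) !(Bsym (B _ _) V).
rewrite !(D1sym _ A) !(D1sym _ (B _ _)) !(D1sym _ V X) !(D2sym34 _ _ V X) !(D2sym12 V X).
apply/rowP => k; rewrite !mxE.
ring.
Qed.

End CurvatureAlgebra.

(** * Derivatives of the Christoffel symbols *)

(** Locked, since unfolding the limits in a derivative makes conversion tests
    between different arguments intractable. *)
HB.lock Definition dGamma (R : realType) (n : nat) (M : riemannianManifold R n)
    (i : chart M) (x w u v : 'rV[R]_n) : 'rV[R]_n :=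
  'D_w (fun y => christoffel i y u v) x.

HB.lock Definition d2Gamma (R : realType) (n : nat)
    (M : riemannianManifold R n) (i : chart M) (x z w u v : 'rV[R]_n) : 'rV[R]_n :=
  'D_z (fun y => dGamma i y w u v) x.

Section ChristoffelDerivatives.
Context (R : realType) (n : nat) (M : riemannianManifold R n) (i : chart M).
Local Notation U := (chart_image i).
Local Notation Gamma := (christoffel i).
Let openU : open U := @chart_image_open _ _ M i.

Local Notation dGamma := (dGamma i).
Local Notation d2Gamma := (d2Gamma i).
Let Gsmooth := @christoffel_smooth R n M i.
Local Opaque christoffel.

Lemma dGammaE x w u v k : U x ->
  dGamma x w u v 0 k = 'D_w (fun y => Gamma y u v 0 k) x.
Proof.
move=> Ux; rewrite dGamma.unlock derive_mx; first by rewrite mxE.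
apply/derivable_mxP => a l; rewrite ord1; apply: diff_derivable.
exact: (smooth_on_differentiable (Gsmooth u v l) Ux).
Qed.

Lemma dGamma_smooth w u v k : smooth_on U (fun y => dGamma y w u v 0 k).
Proof.
apply: (smooth_on_ext openU _ (smooth_on_derive openU w (Gsmooth u v k))).
by move=> x Ux; rewrite dGammaE.
Qed.

Lemma d2GammaE x z w u v k : U x ->
  d2Gamma x z w u v 0 k = 'D_z ('D_w (fun y => Gamma y u v 0 k)) x.
Proof.
move=> Ux; rewrite d2Gamma.unlock derive_mx.
  rewrite mxE; apply: near_eq_derive.
  by apply: (near_open openU) Ux => y Uy; rewrite dGammaE.
apply/derivable_mxP => a l; rewrite ord1; apply: diff_derivable.
exact: (smooth_on_differentiable (dGamma_smooth w u v l) Ux).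
Qed.

Lemma dGamma_sym x w u v : U x -> dGamma x w u v = dGamma x w v u.
Proof.
move=> Ux; apply/rowP => k; rewrite (dGammaE w u v k Ux) (dGammaE w v u k Ux).
apply: near_eq_derive; apply: (near_open openU) Ux => y Uy.
by rewrite (christoffel_sym u v Uy).
Qed.

Lemma dGamma_linear1 x a w w' u v : U x ->
  dGamma x (a *: w + w') u v = a *: dGamma x w u v + dGamma x w' u v.
Proof.
move=> Ux; apply/rowP => k; rewrite row_entry_linear.
rewrite (dGammaE _ u v k Ux) (dGammaE w u v k Ux) (dGammaE w' u v k Ux).
by apply: derive_linear; exact: (smooth_on_differentiable (Gsmooth u v k) Ux).
Qed.

Lemma dGamma_linear3 x w u a v v' : U x ->
  dGamma x w u (a *: v + v') = a *: dGamma x w u v + dGamma x w u v'.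
Proof.
move=> Ux; apply/rowP => k; rewrite row_entry_linear.
rewrite (dGammaE w u _ k Ux) (dGammaE w u v k Ux) (dGammaE w u v' k Ux).
have d v0 : is_derive x w (fun y => Gamma y u v0 0 k)
    ('D_w (fun y => Gamma y u v0 0 k) x).
  split=> //; apply: diff_derivable.
  exact: (smooth_on_differentiable (Gsmooth u v0 k) Ux).
have H := is_deriveD (@is_deriveZ _ _ _ _ a _ _ _ (d v)) (d v').
have [_ <-] := H.
apply: near_eq_derive; apply: (near_open openU) Ux => y Uy.
by rewrite christoffel_linearr// row_entry_linear.
Qed.

Lemma dGamma_linear2 x w a u u' v : U x ->
  dGamma x w (a *: u + u') v = a *: dGamma x w u v + dGamma x w u' v.
Proof. by move=> Ux; rewrite !(dGamma_sym _ _ v)// dGamma_linear3. Qed.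

Lemma d2Gamma_sym12 x z w u v : U x -> d2Gamma x z w u v = d2Gamma x w z u v.
Proof.
move=> Ux; apply/rowP => k; rewrite (d2GammaE z w u v k Ux) (d2GammaE w z u v k Ux).
apply: schwarz.
- apply: (near_open openU) Ux => y Uy.
  exact: (smooth_on_differentiable (Gsmooth u v k) Uy).
- exact: (smooth_on_differentiable (smooth_on_derive openU z (Gsmooth u v k)) Ux).
- exact: (smooth_on_differentiable (smooth_on_derive openU w (Gsmooth u v k)) Ux).
Qed.

Lemma d2Gamma_sym34 x z w u v : U x -> d2Gamma x z w u v = d2Gamma x z w v u.
Proof.
move=> Ux; apply/rowP => k; rewrite (d2GammaE z w u v k Ux) (d2GammaE z w v u k Ux).
apply: near_eq_derive; apply: (near_open openU) Ux => y Uy.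
by rewrite -(dGammaE w u v k Uy) -(dGammaE w v u k Uy) dGamma_sym.
Qed.

Section AlongCurve.
Variables (g : R -> 'rV[R]_n) (s : R) (dg : 'rV[R]_n).
Hypotheses (Ug : U (g s)) (gP : is_derive s 1 g dg).

Lemma near_curve : \forall t \near s, U (g t).
Proof.
have [dgs _] := gP; have c := derivable_continuous dgs.
have nU : nbhs (g s) U by apply: open_nbhs_nbhs.
exact: (c U nU).
Qed.

Lemma is_derive_christoffel_cst u v :
  is_derive s 1 (fun t => Gamma (g t) u v) (dGamma (g s) dg u v).
Proof.
apply/is_derive_mx => a k; rewrite ord1 (dGammaE dg u v k Ug).
have df := smooth_on_differentiable (Gsmooth u v k) Ug.
exact: (is_derive_comp (g := g) df gP).
Qed.

Lemma is_derive_christoffel_r u (v : R -> 'rV[R]_n) dv : is_derive s 1 v dv ->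
  is_derive s 1 (fun t => Gamma (g t) u (v t))
    (dGamma (g s) dg u (v s) + Gamma (g s) u dv).
Proof.
move=> vP; apply/is_derive_mx => a k; rewrite ord1 [X in is_derive _ _ _ X]mxE.
apply: (is_derive_linear_arg (phi := fun v t => Gamma (g t) u v 0 k)
  (dphi := fun v => dGamma (g s) dg u v 0 k)) vP.
  near=> t => c w w'; rewrite christoffel_linearr ?row_entry_linear//.
  by near: t; exact: near_curve.
by move=> w; exact: (is_derive_mx _ _ _ _).1 (is_derive_christoffel_cst u w) 0 k.
Unshelve. all: by end_near. Qed.

Lemma is_derive_christoffel (u v : R -> 'rV[R]_n) du dv :
  is_derive s 1 u du -> is_derive s 1 v dv ->
  is_derive s 1 (fun t => Gamma (g t) (u t) (v t))
    (dGamma (g s) dg (u s) (v s) + Gamma (g s) (u s) dv + Gamma (g s) du (v s)).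
Proof.
move=> uP vP; apply/is_derive_mx => a k; rewrite ord1 [X in is_derive _ _ _ X]mxE.
apply: (is_derive_linear_arg (phi := fun u t => Gamma (g t) u (v t) 0 k)
  (dphi := fun u => (dGamma (g s) dg u (v s) + Gamma (g s) u dv) 0 k)) uP.
  near=> t => c w w'; rewrite christoffel_linearl ?row_entry_linear//.
  by near: t; exact: near_curve.
by move=> w; exact: (is_derive_mx _ _ _ _).1 (is_derive_christoffel_r w vP) 0 k.
Unshelve. all: by end_near. Qed.

Lemma is_derive_dGamma_cst w u v :
  is_derive s 1 (fun t => dGamma (g t) w u v) (d2Gamma (g s) dg w u v).
Proof.
apply/is_derive_mx => a k; rewrite ord1 (d2GammaE dg w u v k Ug).
have df := smooth_on_differentiable (smooth_on_derive openU w (Gsmooth u v k)) Ug.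
apply: near_eq_is_derive (is_derive_comp df gP).
near=> t; rewrite (@dGammaE (g t) w u v k) //.
by near: t; exact: near_curve.
Unshelve. all: by end_near. Qed.

Lemma is_derive_dGamma (w u v : R -> 'rV[R]_n) dw du dv :
  is_derive s 1 w dw -> is_derive s 1 u du -> is_derive s 1 v dv ->
  is_derive s 1 (fun t => dGamma (g t) (w t) (u t) (v t))
    (d2Gamma (g s) dg (w s) (u s) (v s) + dGamma (g s) dw (u s) (v s)
     + dGamma (g s) (w s) du (v s) + dGamma (g s) (w s) (u s) dv).
Proof.
move=> wP uP vP; apply/is_derive_mx => a k.
rewrite ord1 [X in is_derive _ _ _ X]mxE.
apply: (is_derive_linear_arg (phi := fun v t => dGamma (g t) (w t) (u t) v 0 k)
  (dphi := fun v => (d2Gamma (g s) dg (w s) (u s) v + dGamma (g s) dw (u s) v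
     + dGamma (g s) (w s) du v) 0 k)) vP.
  near=> t => c z z'; rewrite dGamma_linear3 ?row_entry_linear//.
  by near: t; exact: near_curve.
move=> z; rewrite [X in is_derive _ _ _ X]mxE.
apply: (is_derive_linear_arg (phi := fun u t => dGamma (g t) (w t) u z 0 k)
  (dphi := fun u => (d2Gamma (g s) dg (w s) u z + dGamma (g s) dw u z) 0 k)) uP.
  near=> t => c y y'; rewrite dGamma_linear2 ?row_entry_linear//.
  by near: t; exact: near_curve.
move=> y; rewrite [X in is_derive _ _ _ X]mxE.
apply: (is_derive_linear_arg (phi := fun w t => dGamma (g t) w y z 0 k)
  (dphi := fun w => d2Gamma (g s) dg w y z 0 k)) wP.
  near=> t => c x x'; rewrite dGamma_linear1 ?row_entry_linear//.
  by near: t; exact: near_curve.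
by move=> x; exact: (is_derive_mx _ _ _ _).1 (is_derive_dGamma_cst x y z) 0 k.
Unshelve. all: by end_near. Qed.

End AlongCurve.

Lemma chart_curvatureE x u v z :
  chart_curvature i x u v z = alg_curvature (Gamma x) (dGamma x) u v z.
Proof. by rewrite /alg_curvature dGamma.unlock. Qed.

Lemma chart_nabla_curvatureE x w u v z : U x ->
  chart_nabla_curvature i x w u v z =
  alg_nabla_curvature (Gamma x) (dGamma x) (d2Gamma x) w u v z.
Proof.
move=> Ux; rewrite /chart_nabla_curvature /alg_nabla_curvature.
suff H : is_derive x w (fun y => chart_curvature i y u v z)
    (d2Gamma x w u v z - d2Gamma x w v u z
     + (dGamma x w u (Gamma x v z) + Gamma x u (dGamma x w v z))
     - (dGamma x w v (Gamma x u z) + Gamma x v (dGamma x w u z))).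
  by rewrite (@derive_val _ _ _ _ _ _ _ H) !chart_curvatureE.
have -> : (fun y => chart_curvature i y u v z) =
    fun y => alg_curvature (Gamma y) (dGamma y) u v z.
  by apply/funext => y; rewrite chart_curvatureE.
apply/is_derive_line.
have lP : is_derive (0 : R) 1 (fun h : R => h *: w + x) w.
  exact: (is_derive_line _ _ _ _).1 (is_derive_id x w).
have l0 : 0 *: w + x = x by rewrite scale0r add0r.
have Ul : U (0 *: w + x) by rewrite l0.
have d1 := is_derive_dGamma_cst Ul lP u v z.
have d2 := is_derive_dGamma_cst Ul lP v u z.
have c1 := is_derive_christoffel_cst Ul lP v z.
have c2 := is_derive_christoffel_cst Ul lP u z.
have b1 := is_derive_christoffel_r Ul lP u c1.
have b2 := is_derive_christoffel_r Ul lP v c2.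
have := is_deriveB (is_deriveD (is_deriveB d1 d2) b1) b2.
by rewrite l0.
Qed.

End ChristoffelDerivatives.

(** * Good triples *)

Section GoodTriples.
Context (R : realType) (n : nat) (M : riemannianManifold R n) (i : chart M).
Local Notation U := (chart_image i).
Local Notation Gamma := (christoffel i).
Local Notation mixed x :=
  (mixed_term (christoffel i x) (dGamma i x) (d2Gamma i x)).
Local Opaque christoffel.

(** The definition of A and the Jacobi equation, as a first order system. *)
Lemma jacobi_in_chart (gamma : R -> M) (J : R -> tvec M) (s : R) :
  jacobi_field gamma J -> dom i (gamma s) ->
  let x := coord i (gamma s) in let X := velocity gamma s i in
  let A := cov_deriv gamma J s i in
  is_derive s 1 (fun u => J u i) (A - Gamma x X (J s i)) /\
  is_derive s 1 (fun u => cov_deriv gamma J u i)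
    (- alg_curvature (Gamma x) (dGamma i x) (J s i) X X - Gamma x X A).
Proof.
move=> jJ ds x X A; have [_ dJ dA jac] := jJ s; split.
  split; first exact: dJ.
  have -> : A = derive1 (fun u => J u i) s + Gamma x X (J s i).
    by rewrite /A /cov_deriv /at_point (asboolT ds).
  by rewrite addrK derive1E.
split; first exact: dA.
have := congr1 (fun z : tvec M => z i) jac.
rewrite -[(_ + _) i]/(cov_deriv gamma (cov_deriv gamma J) s i +
  curvature (gamma s) (J s) (velocity gamma s) (velocity gamma s) i).
rewrite {1}/cov_deriv /curvature /at_point (asboolT ds) derive1E chart_curvatureE.
rewrite -/x -/X -/A -[(0 : tvec M) i]/(0 : 'rV[R]_n) -addrA => /eqP.
by rewrite addr_eq0 => /eqP->; rewrite opprD addrC.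
Qed.

(** Differentiating - Gamma(V, V) twice along gamma and replacing the derivatives
    of gamma, X, V and A by the geodesic and Jacobi equations gives mixed_term. *)
Lemma spray_along_jacobi (p : M) (X V A : tvec M) (gamma : R -> M)
    (J : R -> tvec M) k : dom i p -> jacobi_along_exp p X V A gamma J ->
  exists be : R, forall e : R, 0 < e -> \forall s \near (0 : R),
   `|spray i (coord i (gamma s)) (J s i) 0 k
     - quartic (spray i (coord i p) (V i) 0 k) be
        (mixed (coord i p) (X i) (V i) (A i) 0 k / 2) 0 0 s| <= e * s ^+ 2.
Proof.
move=> dp [[gg g0 gv] [jJ J0 A0]].
have nd : \forall s \near (0 : R), dom i (gamma s).
  have [[gc _] _ _] := gg 0 I; apply: gc; rewrite g0.
  by apply: open_nbhs_nbhs; split => //; exact: dom_open.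
pose x s := coord i (gamma s); pose W s := velocity gamma s i.
pose Y s := J s i; pose C s := cov_deriv gamma J s i.
pose Y1 s := C s - Gamma (x s) (W s) (Y s).
pose f1 s := - (dGamma i (x s) (W s) (Y s) (Y s) + 2 *: Gamma (x s) (Y s) (Y1 s)).
have Ux s : dom i (gamma s) -> U (x s) by move=> ds; exists (gamma s).
have derivs s : dom i (gamma s) -> [/\ is_derive s 1 x (W s),
    is_derive s 1 W (- Gamma (x s) (W s) (W s)), is_derive s 1 Y (Y1 s) &
    is_derive s 1 C (- alg_curvature (Gamma (x s)) (dGamma i (x s)) (Y s) (W s) (W s)
       - Gamma (x s) (W s) (C s))].
  move=> ds; have [dx dW] := geodesic_in_chart (D := setT) gg I ds.
  have [dY dC] := jacobi_in_chart jJ ds.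
  by split; [exact: dx|exact: dW|exact: dY|exact: dC].
have d1 : \forall s \near (0 : R),
    is_derive (s : R) 1 (fun s => spray i (x s) (Y s)) (f1 s).
  apply: filterS nd => s ds; have [dx dW dY dC] := derivs s ds.
  have := is_deriveN (is_derive_christoffel (Ux s ds) dx dY dY).
  move=> H; apply: (is_derive_eq H); rewrite /f1 (christoffel_sym (Y1 s) _ (Ux s ds)).
  by rewrite -addrA scaler_nat mulr2n.
have d0 : dom i (gamma 0) by rewrite g0.
have d2 : is_derive (0:R) 1 f1 (mixed (x 0) (W 0) (Y 0) (C 0)).
  have [dx dW dY dC] := derivs 0 d0.
  have dY1 := is_deriveB dC (is_derive_christoffel (Ux 0 d0) dx dW dY).
  have dD := is_derive_dGamma (Ux 0 d0) dx dW dY dY.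
  have dG := is_derive_christoffel (Ux 0 d0) dx dY dY1.
  have := is_deriveN (is_deriveD dD (@is_deriveZ _ _ _ _ 2 _ _ _ dG)).
  move=> H; apply: (is_derive_eq H); reflexivity.
have := @taylor2 R (fun s => spray i (x s) (Y s) 0 k) (fun s => f1 s 0 k)
   (mixed (x 0) (W 0) (Y 0) (C 0) 0 k).
have -> : x 0 = coord i p by rewrite /x g0.
have -> : W 0 = X i by rewrite /W gv.
have -> : Y 0 = V i by rewrite /Y J0.
have -> : C 0 = A i by rewrite /C A0.
move=> H; exists (f1 0 0 k) => e e0; apply: H e0.
  by apply: filterS d1 => s /is_derive_mx; apply.
by have /is_derive_mx := d2; rewrite /x g0 /W gv /Y J0 /C A0; apply.
Qed.

(** exp_expansion around (p, V), with initial data on the curve gamma, which are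
    near (p, V) for s near 0. *)
Lemma exp_along_jacobi (p : M) (X V A : tvec M) (gamma : R -> M)
    (J : R -> tvec M) k : dom i p -> jacobi_along_exp p X V A gamma J ->
  exists (d : R -> R) (Q : R), forall e : R, 0 < e ->
  exists2 r : R, 0 < r & forall s t : R, `|s| < r -> t != 0 -> `|t| < r ->
  forall q : M, is_exp (gamma s) (t *: J s) q ->
  `|coord i q 0 k - quartic (coord i (gamma s) 0 k) (J s i 0 k)
      (spray i (coord i (gamma s)) (J s i) 0 k / 2) (d s) Q t| <= e * t ^+ 4.
Proof.
move=> dp [[gg g0 gv] [jJ J0 A0]].
have Up : U (coord i p) by exists p.
have [h [Q HQ]] := exp_expansion (V i) k Up.
exists (fun s => h (coord i (gamma s)) (J s i) / 6), (Q / 24) => e e0.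
have [d d0 Hd] := HQ e e0.
have dg0 : dom i (gamma 0) by rewrite g0.
have [dx _] := geodesic_in_chart (D := setT) gg I dg0.
have [dJ _] := jacobi_in_chart jJ dg0.
have N1 : \forall s \near (0 : R), dom i (gamma s).
  have [[gc _] _ _] := gg 0 I; apply: gc; rewrite g0.
  by apply: open_nbhs_nbhs; split => //; exact: dom_open.
have /cvgrPdist_lt /(_ d d0) N2 := derivable_continuous (@ex_derive _ _ _ _ _ _ _ dx).
have /cvgrPdist_lt /(_ d d0) N3 := derivable_continuous (@ex_derive _ _ _ _ _ _ _ dJ).
have [r /= r0 Hr] := (nbhs_ballP _ _).1 (filterI N1 (filterI N2 N3)).
exists (Num.min r d); first by rewrite lt_min r0.
move=> s t; rewrite !lt_min => /andP[sr _] t0 /andP[_ td] q qe.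
have [|ds [xs Js]] := Hr s; first by rewrite -ball_normE/= sub0r normrN.
apply: (Hd (gamma s) q (J s) t qe t0 td ds).
  by move: xs; rewrite /= g0 distrC.
by move: Js; rewrite /= J0 distrC.
Qed.

(** The common points q(s, t) of the two families of geodesics have an expansion
    in t along gamma and one in s along eta. *)
Lemma good_triple_mixed (p : M) (X V A : tvec M) : dom i p ->
  good_triple p X V A ->
  mixed (coord i p) (X i) (V i) (A i) = mixed (coord i p) (V i) (X i) (A i).
Proof.
move=> dp [_ [gamma [eta [JV [JX [jV jX E]]]]]].
have [q Hq] : exists q : R * R -> M, forall z,
    is_exp (gamma z.1) (z.2 *: JV z.1) (q z) /\
    is_exp (eta z.2) (z.1 *: JX z.2) (q z).
  have H (z : R * R) : exists q, is_exp (gamma z.1) (z.2 *: JV z.1) q /\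
      is_exp (eta z.2) (z.1 *: JX z.2) q by exact: E.
  by have [q Hq] := choice H; exists q.
apply/rowP => k.
have [d [Q H1]] := exp_along_jacobi k dp jV.
have [d' [Q' H2]] := exp_along_jacobi k dp jX.
have [be C1] := spray_along_jacobi k dp jV.
have [be' C2] := spray_along_jacobi k dp jX.
apply: (@mixed_second_derivatives R (fun s t => coord i (q (s, t)) 0 k)
  (fun s => coord i (gamma s) 0 k) (fun s => JV s i 0 k)
  (fun s => spray i (coord i (gamma s)) (JV s i) 0 k) d
  (fun s => coord i (eta s) 0 k) (fun s => JX s i 0 k)
  (fun s => spray i (coord i (eta s)) (JX s i) 0 k) d' Q _ be _ Q' _ be' _ _ _ C1 C2).
- move=> e /H1[r r0 Hr]; exists r => // s t sr t0 tr.
  exact: Hr (Hq (s, t)).1.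
- move=> e /H2[r r0 Hr]; exists r => // t s tr s0 sr.
  exact: Hr (Hq (s, t)).2.
Qed.

Lemma good_triple_chart_curvature (p : M) (X V A : tvec M) : dom i p ->
  locally_symmetric M -> good_triple p X V A ->
  chart_curvature i (coord i p) (X i) (V i) (A i) = 0.
Proof.
move=> dp symM gt; set x := coord i p.
have Ux : U x by exists p.
have := mixed_term_swap (B := Gamma x) (D1 := dGamma i x) (D2 := d2Gamma i x)
  (fun u v => christoffel_sym u v Ux)
  (fun u a v w => christoffel_linearr a v w u Ux)
  (fun a u u' v w => dGamma_linear1 a u u' v w Ux)
  (fun u v w => dGamma_sym u v w Ux)
  (fun u v a w w' => dGamma_linear3 u v a w w' Ux)
  (fun u u' v w => d2Gamma_sym12 u u' v w Ux)
  (fun u u' v w => d2Gamma_sym34 u u' v w Ux) (X i) (V i) (A i).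
rewrite (good_triple_mixed dp gt) subrr -!chart_nabla_curvatureE// !symM// subrr sub0r.
rewrite -chart_curvatureE => /esym/eqP; rewrite oppr_eq0 scaler_eq0 pnatr_eq0 /=.
by move=> /eqP.
Qed.

End GoodTriples.

Theorem proposition1p6 (R : realType) (n : nat) (M : riemannianManifold R n)
  (p : M) (X V A : tvec M) :
  locally_symmetric M -> good_triple p X V A -> curvature p X V A = 0.
Proof.
move=> symM gt; apply/funext => i; rewrite /curvature /at_point.
by case: asboolP => // dp; exact: good_triple_chart_curvature.
Qed.
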